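(* Let $\Bbbk$ be a commutative ring, let $H$ be a Hopf algebra over $\Bbbk$ that is involutory and a Frobenius algebra over $\Bbbk$, and let $B/A$ be a right $H$-Galois extension. Assume further that (i) $A$ is commutative without idempotents $\neq 0,1$, and (ii) there exists $f\in T(B)^*$ (that is, a $\Bbbk$-linear form $f\colon B\to\Bbbk$ vanishing on all commutators $bb'-b'b$) with $f(1)=1$. Then $(\operatorname{rank}_A M)\cdot 1\in\mathfrak{d}H$ holds for every finitely generated projective left $B$-module $M$, where $\mathfrak{d}H=\langle\varepsilon,\int_H^l\rangle$ is the ideal of $\Bbbk$ formed by the values of the counit on integrals of $H$.
   Context: $\otimes=\otimes_\Bbbk$. $H$ has counit $\varepsilon$, comultiplication $\Delta$ and antipode $\mathcal S$; $H$ is involutory if $\mathcal S^2=1$. A $\Bbbk$-algebra $R$ is Frobenius if it is finitely generated projective over $\Bbbk$ and $R\cong\operatorname{Hom}_\Bbbk(R,\Bbbk)$ as left $R$-modules, where $(af)(x)=f(xa)$. A right $H$-comodule algebra is a $\Bbbk$-algebra $B$ that is a right $H$-comodule via $\rho\colon B\to B\otimes H$, $b\mapsto\sum b_0\otimes b_1$, with $\rho(ab)=\sum a_0b_0\otimes a_1b_1$ and $\rho(1)=1\otimes 1$. Its subalgebra of coinvariants is $A=B^{co\,H}=\{a\in B\mid\rho(a)=a\otimes 1\}$. The extension $B/A$ is (right) $H$-Galois if the map $B\otimes_A B\to B\otimes H$, $b\otimes\tilde b\mapsto(b\otimes 1)\rho(\tilde b)$, or the map $B\otimes_A B\to B\otimes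 H$, $b\otimes\tilde b\mapsto\rho(b)(\tilde b\otimes 1)$, is bijective; since $H$ is finitely generated projective over $\Bbbk$ (so $\mathcal S$ is bijective), the two conditions are equivalent, and $B$ is then finitely generated projective as a left and as a right $A$-module. Integrals: $\int_H^r=\{a\in H\mid ab=\varepsilon(b)a\ \forall b\in H\}$ and $\int_H^l=\{a\in H\mid ba=\varepsilon(b)a\ \forall b\in H\}$. The ideal $\mathfrak dH$ of $\Bbbk$ is $\mathfrak dH=\varepsilon(\int_H^l)=\varepsilon(\int_H^r)$. For a ring $B$, $T(B)=B/[B,B]$, where $[B,B]$ is the additive subgroup generated by all $bb'-b'b$, and $T(B)^*=\operatorname{Hom}_\Bbbk(T(B),\Bbbk)$. By restriction, every finitely generated projective left $B$-module $M$ is finitely generated projective over $A$. Since the commutative ring $A$ has no idempotents other than $0,1$, the function $\mathfrak p\mapsto\operatorname{rank}_{A_{\mathfrak p}}(A_{\mathfrak p}\otimes_A M)$ on $\operatorname{Spec}A$ is constant; its value is the integer $\operatorname{rank}_A M$, and $(\operatorname{rank}_A M)\cdot 1$ denotes its image in $\Bbbk$. *)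

(* Defs.v *)
From HB Require Import structures.
From mathcomp Require Import all_boot all_order all_algebra.
From mathcomp Require Import boolp classical_sets ring.

Set Implicit Arguments.
Unset Strict Implicit.
Unset Printing Implicit Defensive.

Import GRing.Theory.

Local Open Scope ring_scope.
Local Open Scope quotient_scope.

Reserved Notation "M ⊗ N" (at level 40, left associativity).
Reserved Notation "x ⊠ y" (at level 40, left associativity).

(* The tensor product of abelian groups M and N balanced over S, where S acts
   on M from the right by ra and on N from the left by la.  The word
   [:: (m1, n1); ...; (mr, nr)] stands for m1 ⊗ n1 + ... + mr ⊗ nr; no
   coefficients are needed because - (m ⊗ n) = (- m) ⊗ n. *)
Section Tensor.
Variables (M N : zmodType) (S : Type) (ra : M -> S -> M) (la : S -> N -> N).

Inductive tens_eq : seq (M * N) -> seq (M * N) -> Prop :=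
| TensRefl s : tens_eq s s
| TensSym s t : tens_eq s t -> tens_eq t s
| TensTrans s t u : tens_eq s t -> tens_eq t u -> tens_eq s u
| TensCat s s' t t' :
    tens_eq s s' -> tens_eq t t' -> tens_eq (s ++ t) (s' ++ t')
| TensSwap s t : tens_eq (s ++ t) (t ++ s)
| TensAddl m m' n : tens_eq [:: (m + m', n)] [:: (m, n); (m', n)]
| TensAddr m n n' : tens_eq [:: (m, n + n')] [:: (m, n); (m, n')]
| TensZero : tens_eq [:: (0, 0)] [::]
| TensBal m s n : tens_eq [:: (ra m s, n)] [:: (m, la s n)].

Definition tens_eqb (s t : seq (M * N)) : bool := `[< tens_eq s t >].

Lemma tens_eqb_equiv : equiv_class_of tens_eqb.
Proof.
split=> [s | s t | t s u].
- by apply/asboolP; apply: TensRefl.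
- by apply/asboolP/asboolP; apply: TensSym.
- by move=> /asboolP st /asboolP tu; apply/asboolP; apply: TensTrans st tu.
Qed.

Canonical tens_eqb_equivRel := EquivRelPack tens_eqb_equiv.
Canonical tens_eqb_encModRel := defaultEncModRel tens_eqb.

Definition tens := {eq_quot tens_eqb}.
HB.instance Definition _ : EqQuotient _ tens_eqb tens := EqQuotient.on tens.
HB.instance Definition _ := Choice.on tens.

Lemma tens_quotW (P : tens -> Prop) :
  (forall s, P (\pi_tens s)) -> forall x, P x.
Proof. by move=> h x; rewrite -[x]reprK. Qed.

Lemma tens_piP s t : tens_eq s t <-> \pi_tens s = \pi_tens t.
Proof.
split=> [st|/eqP]; last by rewrite piE => /asboolP.
by apply/eqP; rewrite piE; apply/asboolP.
Qed.

Definition tens_opp_word (s : seq (M * N)) := [seq (- x.1, x.2) | x <- s].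

Lemma tens_zerol n : tens_eq [:: (0, n)] [::].
Proof.
have h : tens_eq [:: (0, n)] [:: (0, n); (0, n)].
  by rewrite -{1}[0 in X in tens_eq X _](addr0 (0 : M)); apply: TensAddl.
have h1 : tens_eq [:: (0, n) ; (0, - n)] [::].
  apply: TensTrans TensZero; apply: TensSym.
  by rewrite -{1}(subrr n); apply: TensAddr.
apply: (@TensTrans _ ([:: (0, n)] ++ [:: (0, n); (0, - n)])).
  by apply: (TensCat (TensRefl [:: (0, n)])); apply: TensSym.
apply: (@TensTrans _ ([:: (0, n)] ++ [:: (0, - n)])) h1.
exact: (TensCat (TensSym h) (TensRefl [:: (0, - n)])).
Qed.

Lemma tens_oppl s : tens_eq (tens_opp_word s ++ s) [::].
Proof.
elim: s => [|[m n] s IH] /=; first exact: TensRefl.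
have h : tens_eq [:: (- m, n); (m, n)] [::].
  apply: TensTrans (tens_zerol n); apply: TensSym.
  by rewrite -{1}(addNr m); apply: TensAddl.
apply: TensTrans h.
rewrite -cat1s -(cat1s (m, n) s) -[[:: _; _]]/([:: (- m, n)] ++ [:: (m, n)]).
apply: (TensCat (TensRefl _)).
rewrite catA -[X in tens_eq _ X]/([::] ++ [:: (m, n)]).
apply: (@TensTrans _ (([:: (m, n)] ++ tens_opp_word s) ++ s)).
  exact: (TensCat (TensSwap _ _) (TensRefl s)).
rewrite -catA.
apply: TensTrans (TensSwap [:: (m, n)] [::]).
exact: (TensCat (TensRefl _) IH).
Qed.

Lemma tens_opp_compat s t :
  tens_eq s t -> tens_eq (tens_opp_word s) (tens_opp_word t).
Proof.
move=> st; have := TensCat (tens_oppl s) (TensRefl (tens_opp_word t)).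
move=> h; apply: TensTrans h.
rewrite -catA -[X in tens_eq X _]cats0; apply: (TensCat (TensRefl _)).
apply: TensSym; apply: TensTrans (TensSwap _ _) _.
exact: TensTrans (TensCat (TensRefl _) st) (tens_oppl t).
Qed.

Definition tens_zero : tens := \pi_tens [::].
Definition tens_add (x y : tens) : tens := \pi_tens (repr x ++ repr y).
Definition tens_opp (x : tens) : tens := \pi_tens (tens_opp_word (repr x)).

Lemma tens_repr s : tens_eq (repr (\pi_tens s)) s.
Proof. by apply/tens_piP; rewrite reprK. Qed.

Lemma tens_addE s t : tens_add (\pi_tens s) (\pi_tens t) = \pi_tens (s ++ t).
Proof. by apply/tens_piP; apply: TensCat; apply: tens_repr. Qed.

Lemma tens_oppE s : tens_opp (\pi_tens s) = \pi_tens (tens_opp_word s).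
Proof. by apply/tens_piP; apply: tens_opp_compat; apply: tens_repr. Qed.

Lemma tens_addA : associative tens_add.
Proof.
move=> x y z; elim/tens_quotW: x => x; elim/tens_quotW: y => y; elim/tens_quotW: z => z.
by rewrite !tens_addE catA.
Qed.
Lemma tens_addC : commutative tens_add.
Proof.
move=> x y; elim/tens_quotW: x => x; elim/tens_quotW: y => y; rewrite !tens_addE;
by apply/tens_piP; apply: TensSwap.
Qed.
Lemma tens_add0 : left_id tens_zero tens_add.
Proof. move=> x; by elim/tens_quotW: x => s; rewrite /tens_zero tens_addE. Qed.
Lemma tens_addN : left_inverse tens_zero tens_opp tens_add.
Proof.
move=> x; elim/tens_quotW: x => s; rewrite tens_oppE tens_addE.
by apply/tens_piP; apply: tens_oppl.
Qed.

HB.instance Definition _ :=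
  GRing.isZmodule.Build tens tens_addA tens_addC tens_add0 tens_addN.

Definition tensor (m : M) (n : N) : tens := \pi_tens [:: (m, n)].

Lemma tens_ind (P : tens -> Prop) :
  (forall m n, P (tensor m n)) -> (forall x y, P x -> P y -> P (x + y)) ->
  forall x, P x.
Proof.
move=> Pt PD; elim/tens_quotW; elim=> [|[m n] s IH].
  by have := Pt 0 0; rewrite /tensor; have /tens_piP -> := TensZero.
by rewrite -cat1s -tens_addE; apply: PD => //; apply: Pt.
Qed.

Lemma tensorDl m m' n : tensor (m + m') n = tensor m n + tensor m' n.
Proof. by rewrite [RHS]tens_addE; apply/tens_piP; apply: TensAddl. Qed.
Lemma tensorDr m n n' : tensor m (n + n') = tensor m n + tensor m n'.
Proof. by rewrite [RHS]tens_addE; apply/tens_piP; apply: TensAddr. Qed.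
Lemma tensor_bal m s n : tensor (ra m s) n = tensor m (la s n).
Proof. by apply/tens_piP; apply: TensBal. Qed.

Record balanced (P : zmodType) (f : M -> N -> P) : Prop := Balanced {
  balDl : forall m m' n, f (m + m') n = f m n + f m' n;
  balDr : forall m n n', f m (n + n') = f m n + f m n';
  bal_act : forall m s n, f (ra m s) n = f m (la s n)
}.

(* The additive map m ⊗ n |-> f m n; meaningful only for balanced f, in
   which case tlift_tensor and tliftD characterize it. *)
Definition tlift (P : zmodType) (f : M -> N -> P) (x : tens) : P :=
  \sum_(mn <- repr x) f mn.1 mn.2.

Section Lift.
Variables (P : zmodType) (f : M -> N -> P).
Hypothesis hf : balanced f.

Lemma tens_eq_sum s t : tens_eq s t ->
  \sum_(mn <- s) f mn.1 mn.2 = \sum_(mn <- t) f mn.1 mn.2.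
Proof.
elim=> {s t} //=.
- by move=> ? ? ? _ -> _ ->.
- by move=> s1 s1' t t' _ h _ h'; rewrite !big_cat h h'.
- by move=> s1 t; rewrite !big_cat /= addrC.
- by move=> m m' n; rewrite !big_cons !big_nil !addr0 /= (balDl hf).
- by move=> m n n'; rewrite !big_cons !big_nil !addr0 /= (balDr hf).
- rewrite big_cons !big_nil addr0 /=; apply: (addIr (f 0 0)).
  by rewrite -(balDl hf) addr0 add0r.
- by move=> m s1 n; rewrite !big_cons !big_nil !addr0 (bal_act hf).
Qed.

Lemma tlift_pi s : tlift f (\pi_tens s) = \sum_(mn <- s) f mn.1 mn.2.
Proof. exact/tens_eq_sum/tens_repr. Qed.

Lemma tlift_tensor m n : tlift f (tensor m n) = f m n.
Proof. by rewrite tlift_pi big_cons big_nil addr0. Qed.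

Lemma tliftD x y : tlift f (x + y) = tlift f x + tlift f y.
Proof.
elim/tens_quotW: x => s; elim/tens_quotW: y => t.
by rewrite [_ + _]tens_addE !tlift_pi big_cat.
Qed.

End Lift.
End Tensor.

Arguments tens {M N S} ra la.
Arguments tensor {M N S ra la} m n.
Arguments tlift {M N S ra la P} f x.
Arguments balanced {M N S} ra la {P} f.

Notation "x ⊠ y" := (tensor x y) : ring_scope.

Section TensorOverComRing.
Variable k : comNzRingType.

Definition tensk (M N : lmodType k) :=
  tens (fun (m : M) (c : k) => c *: m) (fun (c : k) (n : N) => c *: n).

HB.instance Definition _ (M N : lmodType k) := GRing.Zmodule.on (tensk M N).

Local Notation "M ⊗ N" := (tensk M N) : type_scope.

Section Module.
Variables M N : lmodType k.

Definition tensk_scale (c : k) (x : M ⊗ N) : M ⊗ N :=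
  tlift (fun m n => (c *: m) ⊠ n : M ⊗ N) x.

Lemma tensk_scale_bal c :
  balanced (fun (m : M) (c : k) => c *: m) (fun (c : k) (n : N) => c *: n)
    (fun m n => (c *: m) ⊠ n : M ⊗ N).
Proof.
split=> [m m' n | m n n' | m d n].
- by rewrite scalerDr tensorDl.
- by rewrite tensorDr.
- by rewrite scalerA mulrC -scalerA tensor_bal.
Qed.

Lemma tensk_scaleE c (m : M) (n : N) :
  tensk_scale c (m ⊠ n) = (c *: m) ⊠ n.
Proof. exact: (tlift_tensor (tensk_scale_bal c)). Qed.

Lemma tensk_scaleD c : {morph tensk_scale c : x y / x + y}.
Proof. exact: (tliftD (tensk_scale_bal c)). Qed.

Lemma tensk_scaleA a b v :
  tensk_scale a (tensk_scale b v) = tensk_scale (a * b) v.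
Proof.
elim/tens_ind: v => [m n | x y hx hy]; first by rewrite !tensk_scaleE scalerA.
by rewrite !tensk_scaleD hx hy.
Qed.
Lemma tensk_scale1 : left_id 1 tensk_scale.
Proof.
move=> x; elim/tens_ind: x => [m n | x y hx hy]; first by rewrite tensk_scaleE scale1r.
by rewrite tensk_scaleD hx hy.
Qed.
Lemma tensk_scaleDl v : {morph tensk_scale^~ v : a b / a + b}.
Proof.
move=> a b; elim/tens_ind: v => [m n | x y hx hy].
  by rewrite !tensk_scaleE scalerDl tensorDl.
by rewrite !tensk_scaleD hx hy addrACA.
Qed.

HB.instance Definition _ := GRing.Zmodule_isLmodule.Build k (M ⊗ N)
  tensk_scaleA tensk_scale1 tensk_scaleD tensk_scaleDl.

Lemma tensorZl c (m : M) (n : N) :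
  (c *: m) ⊠ n = c *: (m ⊠ n : M ⊗ N) :> M ⊗ N.
Proof. exact: (esym (tensk_scaleE c m n)). Qed.

Lemma tensorZr c (m : M) (n : N) :
  m ⊠ (c *: n) = c *: (m ⊠ n : M ⊗ N) :> M ⊗ N.
Proof. by rewrite -tensorZl -tensor_bal. Qed.

End Module.

(* (A ⊗ B) is only known to be a possibly zero ring, hence not an algType. *)
Section Algebra.
Variables A B : algType k.

Definition tensk_mul (x y : A ⊗ B) : A ⊗ B :=
  tlift (fun a b => tlift (fun a' b' => (a * a') ⊠ (b * b') : A ⊗ B) y) x.

Lemma tensk_mul_bal_in (a : A) (b : B) :
  balanced (fun (m : A) (c : k) => c *: m) (fun (c : k) (n : B) => c *: n)
    (fun a' b' => (a * a') ⊠ (b * b') : A ⊗ B).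
Proof.
split=> [m m' n | m n n' | m d n].
- by rewrite mulrDr tensorDl.
- by rewrite mulrDr tensorDr.
- by rewrite -!scalerAr tensor_bal.
Qed.

Lemma tensk_mul_bal (y : A ⊗ B) :
  balanced (fun (m : A) (c : k) => c *: m) (fun (c : k) (n : B) => c *: n)
    (fun a b => tlift (fun a' b' => (a * a') ⊠ (b * b') : A ⊗ B) y).
Proof.
split=> [m m' n | m n n' | m d n]; elim/tens_ind: y => [u v | x y hx hy].
all: rewrite ?(tlift_tensor (tensk_mul_bal_in _ _)).
all: rewrite ?(tliftD (tensk_mul_bal_in _ _)) ?hx ?hy //.
- by rewrite mulrDl tensorDl.
- by rewrite addrACA.
- by rewrite mulrDl tensorDr.
- by rewrite addrACA.
- by rewrite -!scalerAl tensor_bal.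
Qed.

Lemma tensk_mulE (a a' : A) (b b' : B) :
  tensk_mul (a ⊠ b) (a' ⊠ b') = (a * a') ⊠ (b * b').
Proof.
by rewrite /tensk_mul (tlift_tensor (tensk_mul_bal _))
  (tlift_tensor (tensk_mul_bal_in _ _)).
Qed.

Lemma tensk_mulDl : left_distributive tensk_mul +%R.
Proof. by move=> x y z; apply: (tliftD (tensk_mul_bal z)). Qed.

Lemma tensk_mulDr : right_distributive tensk_mul +%R.
Proof.
move=> x y z; elim/tens_ind: x => [a b | x x' hx hx'].
  by rewrite /tensk_mul !(tlift_tensor (tensk_mul_bal _))
    (tliftD (tensk_mul_bal_in _ _)).
by rewrite !tensk_mulDl hx hx' addrACA.
Qed.

Lemma tensk_mulA : associative tensk_mul.
Proof.
move=> x y z; elim/tens_ind: x => [a b | x x' hx hx']; last first.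
  by rewrite !tensk_mulDl hx hx'.
elim/tens_ind: y => [a' b' | y y' hy hy']; last first.
  by rewrite !(tensk_mulDl, tensk_mulDr) hy hy'.
elim/tens_ind: z => [a2 b2 | z z' hz hz']; last by rewrite !tensk_mulDr hz hz'.
by rewrite !tensk_mulE !mulrA.
Qed.

Lemma tensk_mul1l : left_id (1 ⊠ 1) tensk_mul.
Proof.
move=> x; elim/tens_ind: x => [a b | x y hx hy]; first by rewrite tensk_mulE !mul1r.
by rewrite tensk_mulDr hx hy.
Qed.
Lemma tensk_mul1r : right_id (1 ⊠ 1) tensk_mul.
Proof.
move=> x; elim/tens_ind: x => [a b | x y hx hy]; first by rewrite tensk_mulE !mulr1.
by rewrite tensk_mulDl hx hy.
Qed.

HB.instance Definition _ := GRing.Zmodule_isPzRing.Build (A ⊗ B)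
  tensk_mulA tensk_mul1l tensk_mul1r tensk_mulDl tensk_mulDr.

Lemma tensorM (a a' : A) (b b' : B) :
  (a * a') ⊠ (b * b') = (a ⊠ b : A ⊗ B) * (a' ⊠ b' : A ⊗ B) :> A ⊗ B.
Proof. by rewrite -[LHS]tensk_mulE. Qed.

Lemma tensor1 : 1 ⊠ 1 = 1 :> A ⊗ B.
Proof. by []. Qed.

End Algebra.

Definition tmap (M M' N N' : lmodType k) (f : {linear M -> M'})
    (g : {linear N -> N'}) (x : M ⊗ N) : M' ⊗ N' :=
  tlift (fun m n => f m ⊠ g n : M' ⊗ N') x.

Lemma tmapE (M M' N N' : lmodType k) (f : {linear M -> M'})
    (g : {linear N -> N'}) m n : tmap f g (m ⊠ n) = f m ⊠ g n.
Proof.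
apply: tlift_tensor; split=> [m1 m2 n1 | m1 n1 n2 | m1 c n1].
- by rewrite raddfD tensorDl.
- by rewrite raddfD tensorDr.
- by rewrite !linearZ tensor_bal.
Qed.

Definition tassoc (M N P : lmodType k) (x : (M ⊗ N) ⊗ P) : M ⊗ (N ⊗ P) :=
  tlift (fun y p => tlift (fun m n => m ⊠ (n ⊠ p : N ⊗ P) : M ⊗ (N ⊗ P)) y) x.

Lemma tassocE (M N P : lmodType k) (m : M) (n : N) (p : P) :
  tassoc ((m ⊠ n : M ⊗ N) ⊠ p) = m ⊠ (n ⊠ p : N ⊗ P).
Proof.
have bal_in (p1 : P) :
    balanced (fun (m : M) (c : k) => c *: m) (fun (c : k) (n : N) => c *: n)
      (fun m n => m ⊠ (n ⊠ p1 : N ⊗ P) : M ⊗ (N ⊗ P)).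
  split=> [m1 m2 n1 | m1 n1 n2 | m1 c n1].
  - by rewrite tensorDl.
  - by rewrite tensorDl tensorDr.
  - by rewrite (tensorZl c n1 p1) -tensor_bal.
rewrite /tassoc tlift_tensor ?(tlift_tensor (bal_in _)) //.
split=> [x y p1 | x p1 p2 | x c p1]; first exact: (tliftD (bal_in _)).
- move: x; apply: (@tens_ind M N k) => [m1 n1 | x y hx hy].
    by rewrite !(tlift_tensor (bal_in _)) !tensorDr.
  by rewrite !(tliftD (bal_in _)) hx hy addrACA.
- move: x; apply: (@tens_ind M N k) => [m1 n1 | x y hx hy].
    by rewrite -tensorZl !(tlift_tensor (bal_in _)) (tensorZr c n1 p1)
      -tensor_bal.
  by rewrite scalerDr !(tliftD (bal_in _)) hx hy.
Qed.

End TensorOverComRing.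

Notation "M ⊗ N" := (tensk M N) : type_scope.

(* M is a direct summand of some R^n; 'rV[R]_n is a left R-module. *)
Definition fg_projective (R : nzRingType) (M : lmodType R) : Prop :=
  exists (n : nat) (i : {linear M -> 'rV[R]_n}) (p : {linear 'rV[R]_n -> M}),
    cancel i p.

Section Hopf.
Variable k : comNzRingType.

Record hopf (H : algType k) := Hopf {
  counit : {linear H -> k^o};
  comul : {linear H -> H ⊗ H};
  antipode : {linear H -> H};
  counit_alg : monoid_morphism counit;
  comul_alg : monoid_morphism comul;
  comulA : forall h,
    tassoc (tmap comul idfun (comul h)) = tmap idfun comul (comul h);
  counitl : forall h, tlift (fun a b : H => counit a *: b) (comul h) = h;
  counitr : forall h, tlift (fun a b : H => counit b *: a) (comul h) = h;
  antipodel : forall h,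
    tlift (fun a b : H => antipode a * b) (comul h) = (counit h)%:A;
  antipoder : forall h,
    tlift (fun a b : H => a * antipode b) (comul h) = (counit h)%:A
}.

Definition involutory (H : algType k) (hH : hopf H) : Prop :=
  forall h, antipode hH (antipode hH h) = h.

(* phi : R -> Hom_k(R, k) is left R-linear for (a f)(x) = f (x a). *)
Definition frobenius (R : algType k) : Prop :=
  fg_projective R /\
  exists phi : R -> {linear R -> k^o},
    [/\ bijective phi,
        forall a b x, phi (a + b) x = phi a x + phi b x &
        forall a b x, phi (a * b) x = phi b (x * a)].

Definition left_integral (H : algType k) (hH : hopf H) : set H :=
  [set t | forall b, b * t = counit hH b *: t]%classic.

Definition integral_ideal (H : algType k) (hH : hopf H) : set k :=
  [set (counit hH t : k) | t in left_integral hH]%classic.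

Record comodule_algebra (H : algType k) (hH : hopf H) (B : algType k) :=
  ComoduleAlgebra {
  coact :> {linear B -> B ⊗ H};
  coact_alg : monoid_morphism coact;
  coactA : forall b,
    tassoc (tmap coact idfun (coact b)) = tmap idfun (comul hH) (coact b);
  coact_counit : forall b,
    tlift (fun (b0 : B) (b1 : H) => counit hH b1 *: b0) (coact b) = b
}.

Section Galois.
Variables (H : algType k) (hH : hopf H) (B : algType k).
Variable rho : comodule_algebra hH B.

Definition coinvariant : pred B := fun a => `[< rho a = a ⊠ 1 >].

Variable A : subComNzRingType coinvariant.

(* B ⊗_A B, where A is the coinvariant subring; A need not be central in B. *)
Definition tens_coinv :=
  tens (fun (b : B) (a : A) => b * val a) (fun (a : A) (b : B) => val a * b).
HB.instance Definition _ := GRing.Zmodule.on tens_coinv.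

Definition galois_map (x : tens_coinv) : B ⊗ H :=
  tlift (fun b b' => (b ⊠ 1 : B ⊗ H) * rho b') x.

Definition galois_map' (x : tens_coinv) : B ⊗ H :=
  tlift (fun b b' => rho b * (b' ⊠ 1 : B ⊗ H)) x.

Definition hopf_galois : Prop := bijective galois_map \/ bijective galois_map'.

Lemma coinvariant_val (a : A) : rho (val a) = val a ⊠ 1.
Proof. exact/asboolP/(valP a). Qed.

Lemma galois_map_bal :
  balanced (fun (b : B) (a : A) => b * val a) (fun (a : A) b => val a * b)
    (fun b b' => (b ⊠ 1 : B ⊗ H) * rho b').
Proof.
have [rho1 rhoM] := coact_alg rho.
split=> [b b' c | b c c' | b a c].
- by rewrite tensorDl mulrDl.
- by rewrite raddfD mulrDr.
- by rewrite rhoM coinvariant_val mulrA -tensorM mulr1.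
Qed.

Lemma galois_map'_bal :
  balanced (fun (b : B) (a : A) => b * val a) (fun (a : A) b => val a * b)
    (fun b b' => rho b * (b' ⊠ 1 : B ⊗ H)).
Proof.
have [rho1 rhoM] := coact_alg rho.
split=> [b b' c | b c c' | b a c].
- by rewrite raddfD mulrDl.
- by rewrite tensorDl mulrDr.
- by rewrite rhoM coinvariant_val -mulrA -tensorM mulr1.
Qed.

End Galois.
End Hopf.

Section Localization.
Variables (A : comNzRingType) (p : prime_idealr A).

Definition denom := {s : A | s \notin p}.

Lemma denomM_subproof (s t : denom) : val s * val t \notin p.
Proof. by rewrite prime_idealrM negb_or (valP s) (valP t). Qed.
Lemma denom1_subproof : 1 \notin p.
Proof. by rewrite idealr1. Qed.
Definition denomM (s t : denom) : denom := exist (fun s : A => s \notin p) _ (denomM_subproof s t).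
Definition denom1 : denom := exist (fun s : A => s \notin p) _ denom1_subproof.

Definition frac_eq (x y : A * denom) : bool :=
  `[< exists u : denom,
        val u * (x.1 * val y.2) = val u * (y.1 * val x.2) >].

Lemma frac_eq_equiv : equiv_class_of frac_eq.
Proof.
split=> [x | x y | y x z].
- by apply/asboolP; exists denom1.
- by apply/asboolP/asboolP=> -[u hu]; exists u.
- move=> /asboolP[u hu] /asboolP[v hv]; apply/asboolP.
  exists (denomM (denomM u v) y.2) => /=.
  move: hu hv; case: x y z => [a s] [b t] [c w] /=.
  move: (val u) (val v) (val s) (val t) (val w).
  move=> {}u {}v {}s {}t {}w hu hv.
  have -> : u * v * t * (a * w) = v * w * (u * (a * t)) by ring.
  have -> : u * v * t * (c * s) = u * s * (v * (c * t)) by ring.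
  by rewrite hu -hv; ring.
Qed.

Canonical frac_eq_equivRel := EquivRelPack frac_eq_equiv.
Canonical frac_eq_encModRel := defaultEncModRel frac_eq.

Definition local := {eq_quot frac_eq}.
HB.instance Definition _ : EqQuotient _ frac_eq local := EqQuotient.on local.
HB.instance Definition _ := Choice.on local.

Definition frac (a : A) (s : denom) : local := \pi_local (a, s).

Lemma fracP a s b t :
  frac a s = frac b t <-> exists u : denom, val u * (a * val t) = val u * (b * val s).
Proof.
split=> [/eqP | h]; first by rewrite /frac piE => /asboolP.
by apply/eqP; rewrite /frac piE; apply/asboolP.
Qed.

Lemma local_ind (P : local -> Prop) : (forall a s, P (frac a s)) -> forall x, P x.
Proof.
by move=> Pf x; rewrite -[x]reprK; case: (repr x) => a s; apply: Pf.
Qed.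

Definition local_add (x y : local) : local :=
  frac ((repr x).1 * val (repr y).2 + (repr y).1 * val (repr x).2)
       (denomM (repr x).2 (repr y).2).
Definition local_opp (x : local) : local := frac (- (repr x).1) (repr x).2.
Definition local_mul (x y : local) : local :=
  frac ((repr x).1 * (repr y).1) (denomM (repr x).2 (repr y).2).

Lemma repr_frac a s : exists u : denom,
  val u * ((repr (frac a s)).1 * val s) = val u * (a * val (repr (frac a s)).2).
Proof. by apply/fracP; rewrite /frac -surjective_pairing reprK. Qed.

Lemma local_addE a s b t : local_add (frac a s) (frac b t) =
  frac (a * val t + b * val s) (denomM s t).
Proof.
rewrite /local_add; have [u hu] := repr_frac a s; have [v hv] := repr_frac b t.
apply/fracP; exists (denomM u v) => /=; move: hu hv.
case: (repr (frac a s)) => [a' s'] /=; case: (repr (frac b t)) => [b' t'] /=.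
move: (val u) (val v) (val s) (val t) (val s') (val t').
move=> {}u {}v {}s {}t {}s' {}t' hu hv.
have -> : u * v * ((a' * t' + b' * s') * (s * t)) =
  v * t * t' * (u * (a' * s)) + u * s * s' * (v * (b' * t)) by ring.
by rewrite hu hv; ring.
Qed.

Lemma local_mulE a s b t :
  local_mul (frac a s) (frac b t) = frac (a * b) (denomM s t).
Proof.
rewrite /local_mul; have [u hu] := repr_frac a s; have [v hv] := repr_frac b t.
apply/fracP; exists (denomM u v) => /=; move: hu hv.
case: (repr (frac a s)) => [a' s'] /=; case: (repr (frac b t)) => [b' t'] /=.
move: (val u) (val v) (val s) (val t) (val s') (val t').
move=> {}u {}v {}s {}t {}s' {}t' hu hv.
have -> : u * v * (a' * b' * (s * t)) =
  (u * (a' * s)) * (v * (b' * t)) by ring.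
by rewrite hu hv; ring.
Qed.

Lemma local_oppE a s : local_opp (frac a s) = frac (- a) s.
Proof.
rewrite /local_opp; have [u hu] := repr_frac a s.
by apply/fracP; exists u; rewrite !mulNr !mulrN hu.
Qed.

Lemma frac_eqW a s b t : a * val t = b * val s -> frac a s = frac b t.
Proof. by move=> h; apply/fracP; exists denom1; rewrite h. Qed.

Lemma local_addA : associative local_add.
Proof.
move=> x y z.
elim/local_ind: x => ? ?; elim/local_ind: y => ? ?; elim/local_ind: z => ? ?.
rewrite !local_addE.
by apply: frac_eqW => /=; ring.
Qed.
Lemma local_addC : commutative local_add.
Proof.
move=> x y; elim/local_ind: x => ? ?; elim/local_ind: y => ? ?.
by rewrite !local_addE; apply: frac_eqW => /=; ring.
Qed.
Lemma local_add0 : left_id (frac 0 denom1) local_add.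
Proof.
move=> x; by elim/local_ind: x => ? ?; rewrite local_addE; apply: frac_eqW => /=; ring.
Qed.
Lemma local_addN : left_inverse (frac 0 denom1) local_opp local_add.
Proof.
move=> x; elim/local_ind: x => ? ?; rewrite local_oppE local_addE.
by apply: frac_eqW => /=; ring.
Qed.
Lemma local_mulA : associative local_mul.
Proof.
move=> x y z.
elim/local_ind: x => ? ?; elim/local_ind: y => ? ?; elim/local_ind: z => ? ?.
rewrite !local_mulE.
by apply: frac_eqW => /=; ring.
Qed.
Lemma local_mulC : commutative local_mul.
Proof.
move=> x y; elim/local_ind: x => ? ?; elim/local_ind: y => ? ?.
by rewrite !local_mulE; apply: frac_eqW => /=; ring.
Qed.
Lemma local_mul1 : left_id (frac 1 denom1) local_mul.
Proof.
move=> x; by elim/local_ind: x => ? ?; rewrite local_mulE; apply: frac_eqW => /=; ring.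
Qed.
Lemma local_mulDl : left_distributive local_mul local_add.
Proof.
move=> x y z.
elim/local_ind: x => ? ?; elim/local_ind: y => ? ?; elim/local_ind: z => ? ?.
rewrite !(local_mulE, local_addE).
by apply: frac_eqW => /=; ring.
Qed.
Lemma local_1neq0 : frac 1 denom1 != frac 0 denom1.
Proof.
apply/eqP => /fracP[[u pu]] /=; rewrite !mulr1 mulr0 => u0.
by move: pu; rewrite u0 rpred0.
Qed.

HB.instance Definition _ :=
  GRing.isZmodule.Build local local_addA local_addC local_add0 local_addN.
HB.instance Definition _ := GRing.Zmodule_isComNzRing.Build local
  local_mulA local_mulC local_mul1 local_mulDl local_1neq0.

Definition to_local (a : A) : local := frac a denom1.

Lemma to_local_zmod_morphism : zmod_morphism to_local.
Proof.
move=> a b; transitivity (local_add (frac a denom1) (local_opp (frac b denom1))).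
  by rewrite local_oppE local_addE; apply: frac_eqW => /=; ring.
by [].
Qed.
Lemma to_local_monoid_morphism : monoid_morphism to_local.
Proof.
split=> // a b; transitivity (local_mul (frac a denom1) (frac b denom1)).
  by rewrite local_mulE; apply: frac_eqW => /=; ring.
by [].
Qed.
HB.instance Definition _ :=
  GRing.isZmodMorphism.Build A local to_local to_local_zmod_morphism.
HB.instance Definition _ :=
  GRing.isMonoidMorphism.Build A local to_local to_local_monoid_morphism.

End Localization.

(* M viewed as a module over A through the ring morphism f. *)
Definition restr_scalars (A B : nzRingType) (f : {rmorphism A -> B})
  (M : lmodType B) : Type := M.

Section RestrictScalars.
Variables (A B : nzRingType) (f : {rmorphism A -> B}) (M : lmodType B).

HB.instance Definition _ := GRing.Zmodule.on (restr_scalars f M).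

Definition restr_scale (a : A) (m : restr_scalars f M) : restr_scalars f M :=
  f a *: (m : M).

Lemma restr_scaleA a b v : restr_scale a (restr_scale b v) = restr_scale (a * b) v.
Proof. by rewrite /restr_scale scalerA rmorphM. Qed.
Lemma restr_scale1 : left_id 1 restr_scale.
Proof. by move=> m; rewrite /restr_scale rmorph1 scale1r. Qed.
Lemma restr_scaleDr : right_distributive restr_scale +%R.
Proof. by move=> a m n; rewrite /restr_scale -scalerDr. Qed.
Lemma restr_scaleDl v : {morph restr_scale^~ v : a b / a + b}.
Proof. by move=> a b; rewrite /restr_scale rmorphD scalerDl. Qed.

HB.instance Definition _ := GRing.Zmodule_isLmodule.Build A (restr_scalars f M)
  restr_scaleA restr_scale1 restr_scaleDr restr_scaleDl.
End RestrictScalars.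

(* L ⊗_A M for a ring morphism f : A -> L, as an L-module. *)
Section ExtendScalars.
Variables (A L : comNzRingType) (f : {rmorphism A -> L}) (M : lmodType A).

Let ra (x : L) (a : A) := x * f a.
Let la (a : A) (m : M) := a *: m.

Definition ext_scalars := tens ra la.
HB.instance Definition _ := GRing.Zmodule.on ext_scalars.

Definition ext_scale (c : L) (x : ext_scalars) : ext_scalars :=
  tlift (fun x m => (c * x) ⊠ m : ext_scalars) x.

Lemma ext_scale_bal c : balanced ra la (fun x m => (c * x) ⊠ m : ext_scalars).
Proof.
split=> [x x' m | x m m' | x a m].
- by rewrite mulrDr tensorDl.
- by rewrite tensorDr.
- by rewrite /ra mulrA tensor_bal.
Qed.

Lemma ext_scaleE c (x : L) (m : M) :
  ext_scale c (x ⊠ m : ext_scalars) = (c * x) ⊠ m.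
Proof. exact: (tlift_tensor (ext_scale_bal c)). Qed.
Lemma ext_scaleD c : {morph ext_scale c : x y / x + y}.
Proof. exact: (tliftD (ext_scale_bal c)). Qed.
Lemma ext_scaleA a b v : ext_scale a (ext_scale b v) = ext_scale (a * b) v.
Proof.
elim/tens_ind: v => [x m | x y hx hy]; first by rewrite !ext_scaleE mulrA.
by rewrite !ext_scaleD hx hy.
Qed.
Lemma ext_scale1 : left_id 1 ext_scale.
Proof.
move=> x; elim/tens_ind: x => [x m | x y hx hy]; first by rewrite ext_scaleE mul1r.
by rewrite ext_scaleD hx hy.
Qed.
Lemma ext_scaleDl v : {morph ext_scale^~ v : a b / a + b}.
Proof.
move=> a b; elim/tens_ind: v => [x m | x y hx hy].
  by rewrite !ext_scaleE mulrDl tensorDl.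
by rewrite !ext_scaleD hx hy addrACA.
Qed.

HB.instance Definition _ := GRing.Zmodule_isLmodule.Build L ext_scalars
  ext_scaleA ext_scale1 ext_scaleD ext_scaleDl.
End ExtendScalars.

Section Rank.
Variables (A : comNzRingType) (M : lmodType A).

Definition free_of_rank (R : nzRingType) (N : lmodType R) (n : nat) : Prop :=
  exists g : {linear 'rV[R]_n -> N}, bijective g.

(* Total definite descriptions: the default 0 is never used when M is finitely
   generated projective and A has no idempotents other than 0 and 1. *)
Definition local_rank (p : prime_idealr A) : nat :=
  xget 0%N (free_of_rank (ext_scalars (@to_local A p) M)).

Definition rank : nat :=
  xget 0%N [set r | forall p : prime_idealr A, local_rank p = r]%classic.
End Rank.

(* Main.v *)
Require Import Defs.
From HB Require Import structures.
From mathcomp Require Import all_boot all_order all_algebra.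
From mathcomp Require Import boolp classical_sets.

Import GRing.Theory.
Local Open Scope ring_scope.

(** Write [h1 ⊗ h2] for the comultiplication and [b0 ⊗ b1] for the coaction.
    The rank of [M] is the Hattori-Stallings trace over [A] of the identity of
    [M].  For a Galois extension this trace is expressed, modulo commutators of
    [B], by the regular character of [H], whose values lie in the ideal of
    integrals.

    A Frobenius Hopf algebra with involutive antipode has a left integral [Λ]
    and a linear form [λ] with [h1 λ(h2) = λ(h) 1] and [λ(Λ) = 1]
    ([involutory_frobenius_integrals]).  The form is built as a trace over [H]
    ([trace_form]).  The pair makes [λ(_ Λ2)], [S(Λ1)] a dual basis of [H], so
    that [λ(S(Λ1) h Λ2)] is the trace of right multiplication by [h] on [H].
    As [S] is an involution, this operator is conjugate to left multiplication
    by [S(h)], whose trace is [λ(S(h) S(Λ1) Λ2) = ε(Λ) λ(S(h))].  Hence the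
    regular character of [H] takes its values in [ε(Λ) k]
    ([trace_form_regular]).

    The map [E(b) = b0 λ(b1)] is [A]-linear from [B] to [A].  Choose
    [Σ x ⊗ y] in the tensor square of [B] over [A] that the canonical map
    [x ⊗ y |-> x0 y ⊗ x1] sends to [1 ⊗ Λ].  Then [b = Σ E(b x) y]
    ([coinv_dual_basis]), so [B] is finitely generated projective over [A], and
    so is [M].  If [c] in [B] represents the trace over [B] of the identity of
    [M], then the trace over [A] of the identity of [M] is [Σ E(y c x)].  For a
    form [f] that vanishes on commutators, a computation in [B ⊗ H] gives
    [f(Σ E(y c x)) = f(c0) χ(c1)] with [χ] the regular character of [H]
    ([trace_form_rmul]): the trace over [A] of right multiplication by [c] on
    [B] is [c0 χ(c1)] modulo commutators, because [B ⊗ B] over [A] is [B ⊗ H].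
    So [f] sends this trace into [ε(Λ) k].

    It remains to see that the trace over [A] of the identity of [M] is
    [rank M], where only nonzero ranks matter because the ideal contains 0.  An element of [A] is determined by its images in the
    localizations at prime ideals ([eq_to_local]), and over such a localization
    the module is free of rank [rank M], so the trace is [rank M] there
    ([local_trace]).  Since [f 1 = 1], [f] maps it to [rank M] in [k]. *)

Reserved Notation "\sw_ ( a , b <- x ) F"
  (at level 41, F at level 41, a name, b name, x at level 50,
   format "\sw_ ( a ,  b  <-  x )  F").

(** Sweedler notation: if [x = Σ a ⊗ b] then this is [Σ F a b].  As [tlift] sums
    over a representative word of [x], sums of this kind commute with each other
    and with linear maps unconditionally; multilinearity of [F] only matters
    when [x] is replaced by another expression of the same tensor. *)
Notation "\sw_ ( a , b <- x ) F" := (tlift (fun a b => F) x) : ring_scope.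

Set Implicit Arguments.
Unset Strict Implicit.
Unset Printing Implicit Defensive.

(** * Multilinear expressions and Sweedler sums *)

Section Multilinear.
Variable k : comNzRingType.
Implicit Types U V W M N P Q : lmodType k.

(** A named copy of [linear], so that the tactic [multilinear] below can
    dispatch on the goal. *)
Definition islin U V (f : U -> V) : Prop := linear f.

Definition bilin U V W (F : U -> V -> W) : Prop :=
  (forall u, islin (F u)) /\ (forall v, islin (F^~ v)).

Definition trilin U V W M (F : U -> V -> W -> M) : Prop :=
  (forall u, bilin (F u)) /\ (forall v w, islin (fun u => F u v w)).

Lemma islin_id U : islin (fun u : U => u).
Proof. by []. Qed.

Lemma islin_comp U V W (f : {linear V -> W}) (g : U -> V) :
  islin g -> islin (fun u => f (g u)).
Proof. by move=> hg a u v; rewrite hg linearP. Qed.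

Lemma islin_app U V W (f : V -> W) (g : U -> V) :
  islin f -> islin g -> islin (fun u => f (g u)).
Proof. by move=> hf hg a u v; rewrite hg hf. Qed.

Lemma bilin_appl U M N P (F : M -> N -> P) (g : U -> M) n :
  bilin F -> islin g -> islin (fun u => F (g u) n).
Proof. by move=> hF hg a u v; rewrite hg (hF.2 n). Qed.

Lemma bilin_appr U M N P (F : M -> N -> P) (g : U -> N) m :
  bilin F -> islin g -> islin (fun u => F m (g u)).
Proof. by move=> hF hg a u v; rewrite hg (hF.1 m). Qed.

Lemma trilin_app1 U M N P Q (F : M -> N -> P -> Q) (g : U -> M) n p :
  trilin F -> islin g -> islin (fun u => F (g u) n p).
Proof. by move=> hF hg a u v; rewrite hg (hF.2 n p). Qed.

Lemma trilin_app2 U M N P Q (F : M -> N -> P -> Q) (g : U -> N) m p :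
  trilin F -> islin g -> islin (fun u => F m (g u) p).
Proof. by move=> hF; apply: bilin_appl (hF.1 m). Qed.

Lemma trilin_app3 U M N P Q (F : M -> N -> P -> Q) (g : U -> P) m n :
  trilin F -> islin g -> islin (fun u => F m n (g u)).
Proof. by move=> hF; apply: bilin_appr (hF.1 m). Qed.

Lemma islin_mull U (R : algType k) (c : R) (g : U -> R) :
  islin g -> islin (fun u => c * g u).
Proof. by move=> hg a u v; rewrite hg mulrDr scalerAr. Qed.

Lemma islin_mulr U (R : algType k) (c : R) (g : U -> R) :
  islin g -> islin (fun u => g u * c).
Proof. by move=> hg a u v; rewrite hg mulrDl scalerAl. Qed.

Lemma islin_scaler U V (c : k) (g : U -> V) :
  islin g -> islin (fun u => c *: g u).
Proof. by move=> hg a u v; rewrite hg scalerDr !scalerA mulrC. Qed.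

Lemma islin_scalel U V (v : V) (g : U -> k^o) :
  islin g -> islin (fun u => (g u : k) *: v).
Proof. by move=> hg a u w; rewrite hg scalerDl scalerA. Qed.

Lemma islin_tensorl U M N (n : N) (g : U -> M) :
  islin g -> islin (fun u => g u ⊠ n : M ⊗ N).
Proof. by move=> hg a u w; rewrite hg tensorDl tensorZl. Qed.

Lemma islin_tensorr U M N (m : M) (g : U -> N) :
  islin g -> islin (fun u => m ⊠ g u : M ⊗ N).
Proof. by move=> hg a u w; rewrite hg tensorDr tensorZr. Qed.

Lemma islin_sum U V (I : Type) (r : seq I) (g : I -> U -> V) :
  (forall i, islin (g i)) -> islin (fun u => \sum_(i <- r) g i u).
Proof.
move=> hg a u v; rewrite scaler_sumr -big_split /=.
by apply: eq_bigr => i _; apply: hg.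
Qed.

Lemma islin0 U V (f : U -> V) : islin f -> f 0 = 0.
Proof. by move=> hf; have := hf (-1) 0 0;
    rewrite !scaleN1r oppr0 addr0 addNr. Qed.

Lemma islinD U V (f : U -> V) : islin f -> {morph f : u v / u + v}.
Proof. by move=> hf u v; have := hf 1 u v; rewrite !scale1r. Qed.

Lemma islinZ U V (f : U -> V) c u : islin f -> f (c *: u) = c *: f u.
Proof. by move=> hf; have := hf c u 0; rewrite (islin0 hf) !addr0. Qed.

Lemma bilin_balanced M N P (F : M -> N -> P) : bilin F ->
  balanced (fun (m : M) (c : k) => c *: m) (fun (c : k) (n : N) => c *: n) F.
Proof.
case=> hr hl; split=> [m m' n | m n n' | m c n].
- exact: (islinD (hl n)).
- exact: (islinD (hr m)).
- by rewrite (islinZ c n (hr m)) (islinZ c m (hl n)).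
Qed.

Lemma tliftE M N P (F : M -> N -> P) (m : M) (n : N) :
  bilin F -> tlift F (m ⊠ n : M ⊗ N) = F m n.
Proof. by move=> /bilin_balanced hF; apply: tlift_tensor. Qed.

Lemma tlift_islin M N P (F : M -> N -> P) :
  bilin F -> islin (fun x : M ⊗ N => tlift F x).
Proof.
move=> hF c x y; rewrite (tliftD (bilin_balanced hF)); congr (_ + _).
elim/tens_ind: x => [m n | u v hu hv].
  rewrite -[c *: _]tensorZl !tliftE //.
  exact: (islinZ c m (hF.2 n)).
by rewrite scalerDr !(tliftD (bilin_balanced hF)) hu hv scalerDr.
Qed.

Lemma islin_tlift_arg U M N P (F : M -> N -> P) (g : U -> M ⊗ N) :
  bilin F -> islin g -> islin (fun u => tlift F (g u)).
Proof. by move=> hF hg c u v; rewrite hg; apply: tlift_islin. Qed.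

Lemma islin_tlift_fun U M N P (F : U -> M -> N -> P) (x : M ⊗ N) :
  (forall m n, islin (fun u => F u m n)) -> islin (fun u => tlift (F u) x).
Proof. by move=> hF; apply: islin_sum => p; apply: hF. Qed.

Lemma islin_tlift M N P W (G : P -> W) (F : M -> N -> P) (x : M ⊗ N) :
  islin G -> G (tlift F x) = \sw_(m, n <- x) G (F m n).
Proof.
move=> hG; apply: (big_morph G); [exact: islinD | exact: islin0].
Qed.

Lemma eq_tlift M N P (F F' : M -> N -> P) (x : M ⊗ N) :
  (forall m n, F m n = F' m n) -> tlift F x = tlift F' x.
Proof. by move=> hF; apply: eq_bigr => p _. Qed.

Lemma exchange_tlift M N M' N' P (F : M -> N -> M' -> N' -> P)
    (x : M ⊗ N) (y : M' ⊗ N') :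
  \sw_(m, n <- x) \sw_(m', n' <- y) F m n m' n' =
  \sw_(m', n' <- y) \sw_(m, n <- x) F m n m' n'.
Proof. exact: exchange_big. Qed.

Lemma tlift_sum M N P (I : Type) (r : seq I) (F : I -> M -> N -> P)
    (x : M ⊗ N) :
  \sum_(i <- r) tlift (F i) x = \sw_(m, n <- x) \sum_(i <- r) F i m n.
Proof. exact: exchange_big. Qed.

End Multilinear.

(** Proves multilinearity of an expression in which each bound variable occurs
    exactly once, by following the path from the root to that occurrence.
    Linear maps that are local variables are recognized by the hypotheses
    [islin], [bilin] or [trilin] about them. *)
Ltac multilinear :=
  cbv beta;
  lazymatch goal with
  | |- trilin _ => split=> [?|? ?]; multilinear
  | |- bilin _ => split=> [?|?]; multilinear
  | |- forall _, _ => intro; multilinear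
  | |- islin (fun x => x) => exact: islin_id
  | |- islin (GRing.Linear.sort _) => exact: linearP
  | |- islin _ => first
     [ eassumption
     | match goal with
       | h : islin ?f |- islin (fun x => ?f (@?g x)) =>
           apply: (@islin_app _ _ _ _ f g h); multilinear
       | h : bilin ?F |- islin (fun x => ?F (@?g x) ?c) =>
           apply: (@bilin_appl _ _ _ _ _ F g c h); multilinear
       | h : bilin ?F |- islin (fun x => ?F ?c (@?g x)) =>
           apply: (@bilin_appr _ _ _ _ _ F g c h); multilinear
       | h : trilin ?F |- islin (fun x => ?F (@?g x) ?c ?d) =>
           apply: (@trilin_app1 _ _ _ _ _ _ F g c d h); multilinear
       | h : trilin ?F |- islin (fun x => ?F ?c (@?g x) ?d) =>
           apply: (@trilin_app2 _ _ _ _ _ _ F g c d h); multilinear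
       | h : trilin ?F |- islin (fun x => ?F ?c ?d (@?g x)) =>
           apply: (@trilin_app3 _ _ _ _ _ _ F g c d h); multilinear
       end
     | lazymatch goal with
       | |- islin (fun x => GRing.Linear.sort ?f (@?g x)) =>
           apply: (@islin_comp _ _ _ _ f g); multilinear
       end
     | lazymatch goal with
       | |- islin (fun x => ?c * @?g x) => apply: (@islin_mull _ _ _ c g);
           multilinear
       end
     | lazymatch goal with
       | |- islin (fun x => @?g x * ?c) => apply: (@islin_mulr _ _ _ c g);
           multilinear
       end
     | lazymatch goal with
       | |- @islin _ ?U ?V (fun x => ?c *: @?g x) =>
           apply: (@islin_scaler _ U V c g); multilinear
       end
     | lazymatch goal with
       | |- @islin _ ?U ?V (fun x => @?g x *: ?v) =>
           apply: (@islin_scalel _ U V v g); multilinear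
       end
     | lazymatch goal with
       | |- islin (fun x => tensor ?m (@?g x)) =>
           apply: (@islin_tensorr _ _ _ _ m g); multilinear
       end
     | lazymatch goal with
       | |- islin (fun x => tensor (@?g x) ?n) =>
           apply: (@islin_tensorl _ _ _ _ n g); multilinear
       end
     | lazymatch goal with
       | |- @islin _ _ ?V (fun x => tlift ?F (@?g x)) =>
           apply: (@islin_tlift_arg _ _ _ _ V F g); multilinear
       end
     | lazymatch goal with
       | |- @islin _ _ ?V (fun x => tlift (@?F x) ?t) =>
           apply: (@islin_tlift_fun _ _ _ _ V F t); multilinear
       end
     | lazymatch goal with
       | |- @islin _ ?U ?V (fun x => \sum_(i <- ?r) @?g i x) =>
           apply: (@islin_sum _ U V _ r g); multilinear
       end ]
  end.

(** * Tensor products, comultiplication and antipode *)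

Section TensorMaps.
Variable k : comNzRingType.

Lemma tliftM (R R' : algType k) (P : lmodType k) (F : R -> R' -> P)
    (x y : R ⊗ R') :
  bilin F ->
  tlift F (x * y) =
  \sw_(a, b <- x) \sw_(a', b' <- y) F (a * a') (b * b').
Proof.
move=> hF; pose F2 a b := \sw_(a', b' <- y) F (a * a') (b * b').
have bF2 : bilin F2 by rewrite /F2; multilinear.
elim/tens_ind: x => [a b | u v hu hv]; last first.
  by rewrite mulrDl (islinD (tlift_islin hF)) hu hv
    (islinD (tlift_islin bF2)).
rewrite (tliftE a b bF2) /F2; clear F2 bF2.
have bFab : bilin (fun a' b' => F (a * a') (b * b')) by multilinear.
elim/tens_ind: y => [a' b' | u v hu hv].
  by rewrite -tensorM (tliftE _ _ hF) (tliftE _ _ bFab).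
by rewrite mulrDr (islinD (tlift_islin hF)) hu hv (islinD (tlift_islin bFab)).
Qed.

Lemma tlift_tmap (M M' N N' P : lmodType k) (f : {linear M -> M'})
    (g : {linear N -> N'}) (F : M' -> N' -> P) (x : M ⊗ N) :
  bilin F -> tlift F (tmap f g x) = \sw_(m, n <- x) F (f m) (g n).
Proof.
move=> hF; rewrite (islin_tlift _ _ (tlift_islin hF)).
by apply: eq_tlift => m n; rewrite tliftE.
Qed.

Lemma tlift_tassoc (M N P Q : lmodType k) (F : M -> N -> P -> Q)
    (x : (M ⊗ N) ⊗ P) :
  trilin F ->
  \sw_(m, t <- tassoc x) tlift (F m) t =
  \sw_(t, p <- x) \sw_(m, n <- t) F m n p.
Proof.
move=> [hF hF'].
have bF : bilin (fun (m : M) (t : N ⊗ P) => tlift (F m) t).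
  by split=> [m | t]; [apply: tlift_islin | apply: islin_tlift_fun].
apply: etrans (islin_tlift (M := (M ⊗ N)%type) _ _ (tlift_islin bF)) _.
apply: eq_tlift => t p.
apply: etrans (islin_tlift _ _ (tlift_islin bF)) _.
by apply: eq_tlift => m n; rewrite !tliftE.
Qed.

End TensorMaps.

Section Sweedler.
Variables (k : comNzRingType) (H : algType k) (hH : hopf H).

Local Notation Δ := (comul hH).
Local Notation ε := (counit hH).
Local Notation S := (antipode hH).

(** Stated for an arbitrary coassociative [δ], so that it serves both for the
    comultiplication of [H] and for a coaction. *)
Lemma tlift_coassoc (M P : lmodType k) (δ : {linear M -> M ⊗ H})
    (F : M -> H -> H -> P) (m : M) :
  tassoc (tmap δ idfun (δ m)) = tmap idfun Δ (δ m) -> trilin F ->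
  \sw_(n, h <- δ m) \sw_(n', h' <- δ n) F n' h' h =
  \sw_(n, h <- δ m) \sw_(h', h'' <- Δ h) F n h' h''.
Proof.
move=> hδ hF; have [hFr hFl] := hF.
transitivity (\sw_(n, t <- tmap idfun Δ (δ m)) tlift (F n) t).
  rewrite -hδ tlift_tassoc //.
  apply/esym; apply: etrans (tlift_tmap (M' := (M ⊗ H)%type) _ _ _ _) _ => //.
  split=> [t | h]; last by apply: tlift_islin; split=> [n | n'];
      [exact: (hFr n).2 | exact: hFl].
  by apply: islin_tlift_fun => n h; apply: (hFr n).1.
apply: etrans (tlift_tmap (N' := (H ⊗ H)%type) _ _ _ _) _ => //.
by split=> [n | t]; [apply: tlift_islin | apply: islin_tlift_fun].
Qed.

Lemma coassoc_tlift (P : lmodType k) (F : H -> H -> H -> P) (h : H) :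
  trilin F ->
  \sw_(a, b <- Δ h) \sw_(a', a'' <- Δ a) F a' a'' b =
  \sw_(a, b <- Δ h) \sw_(b', b'' <- Δ b) F a b' b''.
Proof. by move=> hF; apply: tlift_coassoc => //; apply: comulA. Qed.

Lemma counitl_tlift (P : lmodType k) (G : H -> P) (h : H) :
  islin G -> (\sw_(a, b <- Δ h) (ε a : k) *: G b) = G h.
Proof.
move=> hG; rewrite -[in RHS](counitl hH h) (islin_tlift _ _ hG).
by apply: eq_tlift => a b; rewrite islinZ.
Qed.

Lemma counitr_tlift (P : lmodType k) (G : H -> P) (h : H) :
  islin G -> (\sw_(a, b <- Δ h) (ε b : k) *: G a) = G h.
Proof.
move=> hG; rewrite -[in RHS](counitr hH h) (islin_tlift _ _ hG).
by apply: eq_tlift => a b; rewrite islinZ.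
Qed.

Lemma antipodel_tlift (P : lmodType k) (G : H -> P) (h : H) :
  islin G -> (\sw_(a, b <- Δ h) G (S a * b)) = (ε h : k) *: G 1.
Proof. by move=> hG; rewrite -islin_tlift // antipodel islinZ. Qed.

Lemma antipoder_tlift (P : lmodType k) (G : H -> P) (h : H) :
  islin G -> (\sw_(a, b <- Δ h) G (a * S b)) = (ε h : k) *: G 1.
Proof. by move=> hG; rewrite -islin_tlift // antipoder islinZ. Qed.

Lemma comulM_tlift (P : lmodType k) (F : H -> H -> P) (a b : H) :
  bilin F ->
  tlift F (Δ (a * b)) =
  \sw_(a1, a2 <- Δ a) \sw_(b1, b2 <- Δ b) F (a1 * b1) (a2 * b2).
Proof. by move=> hF; rewrite (comul_alg hH).2 tliftM. Qed.

Lemma counitM a b : ε (a * b) = ε a * ε b.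
Proof. exact: (counit_alg hH).2. Qed.

(** [S(a1 b) a2 = S(a1 b1) a2 b2 S(b3) = ε(a b1) S(b2)]: insert
    [ε(b2) = b2 S(b3)] and recognize [S(h1) h2] for [h = a b1]. *)
Lemma antipode_mul_comul a b :
  \sw_(a1, a2 <- Δ a) S (a1 * b) * a2 = (ε a : k) *: S b.
Proof.
transitivity (\sw_(b1, b2 <- Δ b) (\sw_(c, d <- Δ (a * b1)) S c * d) * S b2);
    last first.
  under eq_tlift => b1 b2 do rewrite antipodel counitM -scalerAl mul1r -scalerA.
  rewrite -(islin_tlift _ _ (G := fun x => (ε a : k) *: x));
    last by multilinear.
  by rewrite (counitl_tlift (G := S)) //; multilinear.
under [RHS]eq_tlift => b1 b2.
  rewrite comulM_tlift; last by multilinear.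
  rewrite (islin_tlift (G := fun x => x * S b2)); last by multilinear.
  under eq_tlift => a1 a2.
    rewrite (islin_tlift (G := fun x => x * S b2)); last by multilinear.
    over.
  rewrite exchange_tlift.
  over.
rewrite (coassoc_tlift (F := fun b1 b2 b3 =>
    \sw_(a1, a2 <- Δ a) S (a1 * b1) * (a2 * b2) * S b3));
  last by multilinear.
under [RHS]eq_tlift => b1 b2.
  rewrite exchange_tlift.
  under eq_tlift => a1 a2.
    under eq_tlift => c d do rewrite -!mulrA.
    rewrite (antipoder_tlift (G := fun x => S (a1 * b1) * (a2 * x)));
      last by multilinear.
    over.
  rewrite -(islin_tlift _ _ (G := fun x => (ε b2 : k) *: x));
    last by multilinear.
  over.
rewrite (counitr_tlift (G := fun b1 =>
    \sw_(a1, a2 <- Δ a) S (a1 * b1) * (a2 * 1)));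
  last by multilinear.
by apply: eq_tlift => a1 a2; rewrite mulr1.
Qed.

(** [S(a b) = S(a1 b) a2 S(a3)], and the first two factors collapse by
    [antipode_mul_comul]. *)
Lemma antipodeM a b : S (a * b) = S b * S a.
Proof.
transitivity (\sw_(a1, a2 <- Δ a) (\sw_(c, d <- Δ a1) S (c * b) * d) * S a2);
    last first.
  under eq_tlift => a1 a2 do rewrite antipode_mul_comul -scalerAl.
  by rewrite (counitl_tlift (G := fun x => S b * S x)) //; multilinear.
under [RHS]eq_tlift => a1 a2.
  rewrite (islin_tlift (G := fun x => x * S a2)); last by multilinear.
  over.
rewrite (coassoc_tlift (F := fun a1 a2 a3 => S (a1 * b) * a2 * S a3));
  last by multilinear.
under [RHS]eq_tlift => a1 a2.
  under eq_tlift => c d do rewrite -mulrA.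
  rewrite (antipoder_tlift (G := fun x => S (a1 * b) * x)); last by multilinear.
  rewrite mulr1.
  over.
by rewrite (counitr_tlift (G := fun x => S (x * b))) //; multilinear.
Qed.

Lemma antipode1 : S 1 = 1.
Proof.
have := antipodel hH 1; rewrite (comul_alg hH).1 (counit_alg hH).1 scale1r.
by rewrite -tensor1 tliftE ?mulr1 //; multilinear.
Qed.

Section Integral.
Variable Λ : H.
Hypothesis intΛ : left_integral hH Λ.

(** In [H ⊗ H] this is [Λ1 ⊗ a Λ2 = S(a) Λ1 ⊗ Λ2].  Both sides equal
    [S(a1) a2 Λ1 ⊗ a3 Λ2], since [a2 Λ1 ⊗ a3 Λ2] is the comultiplication of
    [a2 Λ = ε(a2) Λ]. *)
Lemma integral_shift (P : lmodType k) (F : H -> H -> P) (a : H) :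
  bilin F ->
  \sw_(x, y <- Δ Λ) F x (a * y) = \sw_(x, y <- Δ Λ) F (S a * x) y.
Proof.
move=> hF.
transitivity (\sw_(a1, a2 <- Δ a)
    \sw_(x, y <- Δ (a2 * Λ)) F (S a1 * x) y); last first.
  under eq_tlift => a1 a2.
    rewrite (intΛ a2).
    rewrite (islinZ (f := fun h => \sw_(x, y <- Δ h) F (S a1 * x) y));
      last by multilinear.
    over.
  by rewrite (counitr_tlift (G := fun b =>
      \sw_(x, y <- Δ Λ) F (S b * x) y)) //; multilinear.
under [RHS]eq_tlift => a1 a2.
  rewrite comulM_tlift; last by multilinear.
  under eq_tlift => c d do under eq_tlift => x y do rewrite mulrA.
  over.
rewrite -(coassoc_tlift (F := fun a1 a2 a3 =>
    \sw_(x, y <- Δ Λ) F (S a1 * a2 * x) (a3 * y)));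
  last by multilinear.
under [RHS]eq_tlift => a1 a2.
  rewrite (antipodel_tlift (G := fun b =>
      \sw_(x, y <- Δ Λ) F (b * x) (a2 * y)));
    last by multilinear.
  under eq_tlift => x y do rewrite mul1r.
  over.
by rewrite (counitl_tlift (G := fun b =>
    \sw_(x, y <- Δ Λ) F x (b * y))) //; multilinear.
Qed.

End Integral.
End Sweedler.

(** * Integrals of an involutory Frobenius Hopf algebra *)

Section InvolutoryIntegral.
Variables (k : comNzRingType) (H : algType k) (hH : hopf H).
Hypothesis invS : involutory hH.

Local Notation Δ := (comul hH).
Local Notation ε := (counit hH).
Local Notation S := (antipode hH).

Lemma counit_antipode h : ε (S h) = ε h.
Proof.
have -> : ε h = (ε h : k) *: ε 1 by rewrite (counit_alg hH).1 [RHS]mulr1.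
rewrite -(antipodel_tlift hH h (linearP ε : islin ε)).
under eq_tlift => a b do rewrite counitM mulrC.
by rewrite (counitr_tlift hH (G := fun x => ε (S x))) //; multilinear.
Qed.

(** [S(h2) h1 = S(S(h1) h2)] when [S] is an involution. *)
Lemma antipode_opl_tlift (P : lmodType k) (G : H -> P) (h : H) :
  islin G -> (\sw_(a, b <- Δ h) G (S b * a)) = (ε h : k) *: G 1.
Proof.
move=> hG; rewrite -(antipode1 hH).
rewrite -(antipodel_tlift hH (G := fun x => G (S x))).
  by apply: eq_tlift => a b; rewrite antipodeM invS.
by multilinear.
Qed.

Section Integral.
Variable Λ : H.
Hypothesis intΛ : left_integral hH Λ.

(** In the triple tensor power this is
    [Λ1 ⊗ a Λ2 ⊗ Λ3 = S(a1) Λ1 ⊗ Λ2 ⊗ S(a2) Λ3].  By [antipode_opl_tlift],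
    [a y1 ⊗ y2] is [a1 y1 ⊗ S(a3) a2 y2], the product of [1 ⊗ S(a2)] and of the
    comultiplication of [a1 y]; [integral_shift] then moves [a1]. *)
Lemma integral_shift3 (P : lmodType k) (F : H -> H -> H -> P) (a : H) :
  trilin F ->
  \sw_(x, y <- Δ Λ) \sw_(y1, y2 <- Δ y) F x (a * y1) y2 =
  \sw_(a1, a2 <- Δ a) \sw_(x, y <- Δ Λ)
      \sw_(y1, y2 <- Δ y) F (S a1 * x) y1 (S a2 * y2).
Proof.
move=> hF.
have split_a x y : (\sw_(y1, y2 <- Δ y) F x (a * y1) y2) =
    \sw_(a1, a2 <- Δ a) \sw_(z1, z2 <- Δ (a1 * y)) F x z1 (S a2 * z2).
  under [RHS]eq_tlift => a1 a2.
    rewrite comulM_tlift; last by multilinear.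
    under eq_tlift => b1 b2 do under eq_tlift => y1 y2 do rewrite mulrA.
    over.
  rewrite (coassoc_tlift hH (F := fun b1 b2 b3 =>
    (\sw_(y1, y2 <- Δ y) F x (b1 * y1) (S b3 * b2 * y2)))); last by multilinear.
  under [RHS]eq_tlift => a1 a2.
    rewrite (antipode_opl_tlift (G := fun b =>
      (\sw_(y1, y2 <- Δ y) F x (a1 * y1) (b * y2)))); last by multilinear.
    under eq_tlift => y1 y2 do rewrite mul1r.
    over.
  by rewrite (counitr_tlift hH (G := fun b =>
    (\sw_(y1, y2 <- Δ y) F x (b * y1) y2))) //; multilinear.
under eq_tlift => x y do rewrite split_a.
rewrite exchange_tlift; apply: eq_tlift => a1 a2.
by rewrite (integral_shift intΛ (F := fun x y =>
  (\sw_(z1, z2 <- Δ y) F x z1 (S a2 * z2)))) //; multilinear.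
Qed.

Section TraceIntegral.
Variables (ψ : {linear H -> k^o}) (n : nat) (e : 'I_n -> H).
Variable e' : 'I_n -> {linear H -> k^o}.
Hypothesis ee' : forall h, \sum_i (e' i h : k) *: e i = h.

Lemma dual_basis_islin (P : lmodType k) (G : H -> P) h :
  islin G -> \sum_i (e' i h : k) *: G (e i) = G h.
Proof.
move=> hG; rewrite -{2}(ee' h) (big_morph G (islinD hG) (islin0 hG)).
by apply: eq_bigr => i _; rewrite islinZ.
Qed.

(** The trace over [H] of the operator [z |-> u1 ψ(u2)], where [u = z h].  Such
    averaging produces an integral in the dual of [H], up to normalization. *)
Definition trace_form (h : H) : k^o :=
  \sum_i (\sw_(a, b <- Δ (e i * h)) e' i a * ψ b).

Lemma trace_form_islin : islin trace_form.
Proof. by rewrite /trace_form; multilinear. Qed.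

(** The element [ψ(Λ2) S(Λ1) Λ3]. *)
Definition trace_vec : H :=
  \sw_(x, y <- Δ Λ) \sw_(a, b <- Δ x) (ψ b : k) *: (S a * y).

(** In [H ⊗ H] this is [Λ1 λ(Λ2) ⊗ Λ3 = 1 ⊗ w], with [λ] the trace form and [w]
    the element [trace_vec].  Expand [λ] and apply [integral_shift3] to move
    each [e i] away from [Λ2]; the dual basis property then turns the sum over
    [i] into [S(Λ2) Λ1 ψ(Λ4) ⊗ S(Λ3) Λ5], where [S(Λ2) Λ1] collapses. *)
Lemma trace_form_integral (P : lmodType k) (F : H -> H -> P) :
  bilin F ->
  \sw_(x, y <- Δ Λ) \sw_(y1, y2 <- Δ y) (trace_form y1 : k) *: F x y2
  = F 1 trace_vec.
Proof.
move=> hF; pose μ i z := \sw_(a, b <- Δ z) (e' i a * ψ b : k^o).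
have hμ i : islin (μ i) by rewrite /μ; multilinear.
transitivity (\sum_i
    (\sw_(x, y <- Δ Λ) \sw_(y1, y2 <- Δ y) (μ i (e i * y1) : k) *: F x y2)).
  rewrite tlift_sum; apply: eq_tlift => x y.
  rewrite tlift_sum; apply: eq_tlift => y1 y2.
  by rewrite scaler_suml.
under eq_bigr => i _.
  have hμi := hμ i.
  rewrite (integral_shift3 (F := fun x y z => (μ i y : k) *: F x z));
    last by multilinear.
  rewrite exchange_tlift.
  under eq_tlift => x y.
    rewrite exchange_tlift.
    under eq_tlift => y1 y2.
      rewrite -(islin_tlift _ _ (G := fun z => (μ i y1 : k) *: z));
        last by multilinear.
      over.
    over.
  over.
rewrite tlift_sum.
under eq_tlift => x y.
  rewrite tlift_sum.
  under eq_tlift => y1 y2.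
    have -> : \sum_i (μ i y1 : k) *:
        (\sw_(a, b <- Δ (e i)) F (S a * x) (S b * y2)) =
      \sw_(c, d <- Δ y1) \sw_(a, b <- Δ c) (ψ d : k) *: F (S a * x) (S b * y2).
      under eq_bigr => i _.
        rewrite (islin_tlift (G := fun z : k^o => (z : k) *:
            (\sw_(a, b <- Δ (e i)) F (S a * x) (S b * y2))));
          last by multilinear.
        over.
      rewrite tlift_sum; apply: eq_tlift => c d.
      rewrite -(dual_basis_islin (G := fun c =>
          \sw_(a, b <- Δ c) (ψ d : k) *: F (S a * x) (S b * y2)));
        last by multilinear.
      apply: eq_bigr => i _.
      rewrite -(islin_tlift _ _ (G := fun z => (ψ d : k) *: z));
        last by multilinear.
      by rewrite scalerA.
    rewrite (coassoc_tlift hH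
        (F := fun a b d => (ψ d : k) *: F (S a * x) (S b * y2)));
      last by multilinear.
    over.
  rewrite (coassoc_tlift hH (F := fun a t y2 =>
      \sw_(b, d <- Δ t) (ψ d : k) *: F (S a * x) (S b * y2)));
    last by multilinear.
  over.
rewrite -(coassoc_tlift hH (F := fun x a u => \sw_(t, y2 <- Δ u)
    \sw_(b, d <- Δ t) (ψ d : k) *: F (S a * x) (S b * y2)));
  last by multilinear.
under eq_tlift => v u.
  rewrite (antipode_opl_tlift (G := fun z => \sw_(t, y2 <- Δ u)
      \sw_(b, d <- Δ t) (ψ d : k) *: F z (S b * y2)));
    last by multilinear.
  over.
rewrite (counitl_tlift hH (G := fun u => \sw_(t, y2 <- Δ u)
    \sw_(b, d <- Δ t) (ψ d : k) *: F 1 (S b * y2)));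
  last by multilinear.
rewrite /trace_vec (islin_tlift (G := F 1)); last exact: hF.1.
apply: eq_tlift => x y; rewrite (islin_tlift (G := F 1)); last exact: hF.1.
by apply: eq_tlift => a b; rewrite (islinZ _ _ (hF.1 1)).
Qed.

Hypothesis ψΛ : ψ Λ = 1.

Lemma counit_trace_vec : ε trace_vec = 1.
Proof.
rewrite /trace_vec (islin_tlift _ _ (linearP ε : islin ε)).
under eq_tlift => x y.
  rewrite (islin_tlift _ _ (linearP ε : islin ε)).
  under eq_tlift => a b.
    rewrite linearZ /= counitM counit_antipode.
    have -> : (ψ b : k) *: (ε a * ε y : k^o) = (ε a : k) *: ((ε y : k) *: ψ b).
      by rewrite [RHS]mulrA [LHS]mulrC.
    over.
  rewrite (counitl_tlift hH (G := fun b => (ε y : k) *: ψ b));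
    last by multilinear.
  over.
by rewrite (counitr_tlift hH (G := ψ)) //; multilinear.
Qed.

Lemma trace_form_unit : (\sw_(x, y <- Δ Λ) (trace_form y : k) *: x) = 1.
Proof.
have hl := trace_form_islin.
rewrite -[RHS]scale1r -[X in X *: _]counit_trace_vec.
rewrite -(trace_form_integral (F := fun x y => (ε y : k) *: x));
  last by multilinear.
apply: eq_tlift => x y.
rewrite -[in LHS](counitr hH y) (islin_tlift _ _ hl).
rewrite (islin_tlift _ _ (G := fun z : k^o => (z : k) *: x));
  last by multilinear.
by apply: eq_tlift => a b; rewrite (islinZ _ _ hl) scalerA mulrC.
Qed.

(** The dual basis property of [λ] and [Λ]: replacing [h] by [S(h)] gives
    [h = λ(S(h) Λ2) Λ1]. *)
Lemma trace_form_shift h :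
  \sw_(x, y <- Δ Λ) (trace_form (h * y) : k) *: x = S h.
Proof.
have hl := trace_form_islin.
rewrite (integral_shift intΛ (F := fun x y => (trace_form y : k) *: x));
  last by multilinear.
under eq_tlift => x y do rewrite scalerAr.
by rewrite -(islin_tlift
    (G := fun z => S h * z)) ?trace_form_unit ?mulr1 //; multilinear.
Qed.

(** Expand [h = λ(S(h) Λ2) Λ1] and use [trace_form_integral]: the left-hand side
    becomes the multiple [λ(S(h) w)] of [1], and [ε] identifies the factor. *)
Lemma trace_form_coinv h :
  \sw_(a, b <- Δ h) (trace_form b : k) *: a = (trace_form h : k) *: 1.
Proof.
have hl := trace_form_islin.
set c := trace_form (S h * trace_vec).
have hc : (\sw_(a, b <- Δ h) (trace_form b : k) *: a) = (c : k) *: 1.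
  rewrite -[X in Δ X]invS -(trace_form_shift (S h)).
  rewrite (islin_tlift (G := fun z =>
      \sw_(a, b <- Δ z) (trace_form b : k) *: a));
    last by multilinear.
  rewrite -(trace_form_integral
      (F := fun x y => (trace_form (S h * y) : k) *: x));
    last by multilinear.
  rewrite -(coassoc_tlift hH (F := fun a b y =>
      (trace_form b : k) *: ((trace_form (S h * y) : k) *: a)));
    last by multilinear.
  apply: eq_tlift => x y.
  rewrite (islinZ (f := fun z => \sw_(a, b <- Δ z) (trace_form b : k) *: a));
    last by multilinear.
  rewrite (islin_tlift (G := fun z => (trace_form (S h * y) : k) *: z));
    last by multilinear.
  by apply: eq_tlift => a b; rewrite !scalerA mulrC.
rewrite hc; congr (_ *: _).
rewrite -[LHS]mulr1 -[X in _ * X](counit_alg hH).1 -[LHS]/((c : k) *: ε 1)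
    -linearZ /= -hc.
rewrite (islin_tlift _ _ (linearP ε : islin ε)).
under eq_tlift => a b do rewrite linearZ /= [_ *: _]mulrC.
by rewrite (counitl_tlift hH (G := trace_form)) //; multilinear.
Qed.

Lemma trace_form_norm : trace_form Λ = 1.
Proof.
have := congr1 ε (trace_form_coinv Λ).
rewrite trace_form_unit linearZ /= (counit_alg hH).1.
by rewrite [RHS]mulr1.
Qed.

(** Both sides are the trace of right multiplication by [h] on [H], which [S]
    conjugates to left multiplication by [S(h)].  Concretely, expand
    [S(Λ1) h = S(S(h) Λ1)] by [trace_form_shift] for a second copy of [Λ], then
    contract the first copy by the same lemma. *)
Lemma trace_form_regular h :
  \sw_(x, y <- Δ Λ) trace_form (S x * h * y) = (ε Λ : k) *: trace_form (S h).
Proof.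
have hl := trace_form_islin.
transitivity (\sw_(x, y <- Δ Λ) \sw_(x', y' <- Δ Λ)
    trace_form (S h * ((trace_form (x' * y) : k) *: x) * y')).
  apply: eq_tlift => x y.
  rewrite -{1}(invS h) -antipodeM -trace_form_shift.
  rewrite (islin_tlift (G := fun z => trace_form (z * y))); last by multilinear.
  apply: eq_tlift => x' y'.
  rewrite -scalerAr -!scalerAl !(islinZ _ _ hl).
  by rewrite -[LHS]/(_ * _) -[RHS]/(_ * _) mulrC.
rewrite exchange_tlift.
under eq_tlift => x y.
  rewrite -(islin_tlift _ _ (G := fun z => trace_form (S h * z * y)));
    last by multilinear.
  rewrite trace_form_shift -mulrA.
  over.
by rewrite (antipodel_tlift hH
    (G := fun z => trace_form (S h * z))) ?mulr1 //; multilinear.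
Qed.

End TraceIntegral.
End Integral.
End InvolutoryIntegral.

Section Frobenius.
Variables (k : comNzRingType).

Lemma linear_ext (U V : lmodType k) (f g : {linear U -> V}) : f =1 g -> f = g.
Proof.
case: f g => [f [[f1] [f2]]] [g [[g1] [g2]]] /= /funext fg.
case: g / fg g1 g2 => g1 g2.
by rewrite (Prop_irrelevance f1 g1) (Prop_irrelevance f2 g2).
Qed.

(** Let [ψ] generate the dual of [H].  The element [Λ] with [ψ(_ Λ) = ε] is a
    left integral, because [ψ(x b Λ) = ε(x) ε(b) = ψ(x (ε(b) Λ))] for all [x]. *)
Lemma frobenius_integral (H : algType k) (hH : hopf H) : frobenius H ->
  exists (ψ : {linear H -> k^o}) (Λ : H), left_integral hH Λ /\ ψ Λ = 1.
Proof.
case=> _ [φ [[φ' φK φ'K] _ φM]].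
have φE a x : φ a x = φ 1 (x * a) by rewrite -[a in LHS]mulr1 φM.
exists (φ 1), (φ' (counit hH)).
have φΛ x : φ 1 (x * φ' (counit hH)) = counit hH x by rewrite -φE φ'K.
split=> [b|]; last by rewrite -[φ' _]mul1r φΛ (counit_alg hH).1.
apply: (can_inj φK); apply: linear_ext => x.
by rewrite φE [RHS]φE mulrA φΛ -scalerAr linearZ /= φΛ counitM mulrC.
Qed.

Lemma fg_projective_dual_basis (R : nzRingType) (M : lmodType R) :
  fg_projective M ->
  exists (n : nat) (m : 'I_n -> M) (m' : 'I_n -> {linear M -> R^o}),
    forall x, \sum_i (m' i x : R) *: m i = x.
Proof.
case=> n [i [p ip]].
have hc j : linear (fun x => i x 0 j : R^o).
  by move=> a x y; rewrite linearP !mxE.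
pose m' j : {linear M -> R^o} :=
  HB.pack (fun x => i x 0 j : R^o) (GRing.isLinear.Build R M R^o _ _ (hc j)).
exists n, (fun j => p (delta_mx 0 j)), m' => x.
rewrite -[RHS]ip [X in p X]row_sum_delta linear_sum.
by apply: eq_bigr => j _; rewrite linearZ.
Qed.

Lemma involutory_frobenius_integrals (H : algType k) (hH : hopf H) :
  involutory hH -> frobenius H ->
  exists (Λ : H) (λ : H -> k^o),
    [/\ left_integral hH Λ, islin λ, λ Λ = 1,
        forall h, \sw_(a, b <- comul hH h) (λ b : k) *: a = (λ h : k) *: 1
      & forall h, \sw_(x, y <- comul hH Λ) λ (antipode hH x * h * y) =
                  (counit hH Λ : k) *: λ (antipode hH h)].
Proof.
move=> invS frobH; have [ψ [Λ [intΛ ψΛ]]] := frobenius_integral hH frobH.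
have [n [e [e' ee']]] := fg_projective_dual_basis frobH.1.
exists Λ, (trace_form hH ψ e e'); split=> //.
- exact: trace_form_islin.
- exact: (trace_form_norm invS intΛ).
- exact: (trace_form_coinv invS intΛ).
- exact: (trace_form_regular invS intΛ).
Qed.

End Frobenius.

(** * Traces along a Hopf-Galois extension *)

Section TensorProduct.
Variables (k : comNzRingType) (R R' : algType k).

Lemma mul_tensorl (a : R) (b : R') (y : R ⊗ R') :
  (a ⊠ b : R ⊗ R') * y = \sw_(a', b' <- y) ((a * a') ⊠ (b * b') : R ⊗ R').
Proof. exact: (tlift_tensor (tensk_mul_bal y)). Qed.

Lemma mul_tensorr (a : R) (b : R') (y : R ⊗ R') :
  y * (a ⊠ b : R ⊗ R') = \sw_(a', b' <- y) ((a' * a) ⊠ (b' * b) : R ⊗ R').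
Proof.
elim/tens_ind: y => [a' b' | y z hy hz].
  by rewrite -tensorM tliftE //; multilinear.
rewrite mulrDl hy hz (islinD (tlift_islin _)) //; multilinear.
Qed.

Lemma tlift_tensorK (x : R ⊗ R') : (\sw_(a, b <- x) (a ⊠ b : R ⊗ R')) = x.
Proof.
rewrite -[RHS]mul1r -tensor1 mul_tensorl.
by apply: eq_tlift => a b; rewrite !mul1r.
Qed.

End TensorProduct.

Section Galois.
Variables (k : comNzRingType) (H : algType k) (hH : hopf H) (B : algType k).
Variable rho : comodule_algebra hH B.
Variable A : subComNzRingType (coinvariant rho).
Hypothesis invS : involutory hH.

Local Notation Δ := (comul hH).
Local Notation ε := (counit hH).
Local Notation S := (antipode hH).

Lemma coactM_tlift (P : lmodType k) (F : B -> H -> P) (a b : B) :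
  bilin F ->
  tlift F (rho (a * b)) =
  \sw_(a0, a1 <- rho a) \sw_(b0, b1 <- rho b) F (a0 * b0) (a1 * b1).
Proof. by move=> hF; rewrite (coact_alg rho).2 tliftM. Qed.

Lemma coactA_tlift (P : lmodType k) (F : B -> H -> H -> P) (b : B) :
  trilin F ->
  \sw_(b0, b1 <- rho b) \sw_(c0, c1 <- rho b0) F c0 c1 b1 =
  \sw_(b0, b1 <- rho b) \sw_(h1, h2 <- Δ b1) F b0 h1 h2.
Proof. by move=> hF; apply: tlift_coassoc => //; apply: coactA. Qed.

Lemma coact_counit_tlift (P : lmodType k) (G : B -> P) (b : B) :
  islin G -> (\sw_(b0, b1 <- rho b) (ε b1 : k) *: G b0) = G b.
Proof.
move=> hG; rewrite -[in RHS](coact_counit rho b) (islin_tlift _ _ hG).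
by apply: eq_tlift => b0 b1; rewrite islinZ.
Qed.

(** The map [b ⊗ h |-> b0 ⊗ b1 S(h)], which carries one canonical map of the
    extension to the other, so that surjectivity of one gives that of the
    other. *)
Definition coact_antipode (t : B ⊗ H) : B ⊗ H :=
  \sw_(b, h <- t) \sw_(b0, b1 <- rho b) (b0 ⊠ (b1 * S h) : B ⊗ H).

Lemma coact_antipode_islin : islin coact_antipode.
Proof. by apply: tlift_islin; multilinear. Qed.

Lemma coact_antipodeE b h :
  coact_antipode (b ⊠ h) = \sw_(b0, b1 <- rho b) (b0 ⊠ (b1 * S h) : B ⊗ H).
Proof. by rewrite [LHS]tliftE //; multilinear. Qed.

Lemma galois_map_swap (x y : B) :
  coact_antipode ((x ⊠ 1 : B ⊗ H) * rho y) = rho x * (y ⊠ 1 : B ⊗ H).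
Proof.
have hl := coact_antipode_islin.
rewrite mul_tensorl (islin_tlift _ _ hl) mul_tensorr.
under eq_tlift => y0 y1.
  rewrite coact_antipodeE mul1r coactM_tlift; last by multilinear.
  rewrite exchange_tlift.
  over.
rewrite (coactA_tlift (F := fun y0 y1 y2 =>
    \sw_(x0, x1 <- rho x) ((x0 * y0) ⊠ (x1 * y1 * S y2) : B ⊗ H)));
  last by multilinear.
under eq_tlift => y0 y1.
  under eq_tlift => h1 h2 do under eq_tlift => x0 x1 do rewrite -mulrA.
  rewrite (antipoder_tlift hH (G := fun z =>
      \sw_(x0, x1 <- rho x) ((x0 * y0) ⊠ (x1 * z) : B ⊗ H)));
    last by multilinear.
  over.
by rewrite (coact_counit_tlift (G := fun z =>
    \sw_(x0, x1 <- rho x) ((x0 * z) ⊠ (x1 * 1) : B ⊗ H))) //; multilinear.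
Qed.

Lemma hopf_galois_preimage (h : H) : hopf_galois A ->
  exists s : seq (B * B),
    \sum_(p <- s) rho p.1 * (p.2 ⊠ 1 : B ⊗ H) = 1 ⊠ h :> B ⊗ H.
Proof.
case=> [[g _ gK] | [g _ gK]]; last by exists (repr (g (1 ⊠ h))); apply: gK.
exists (repr (g (1 ⊠ S h))).
under eq_bigr => p _ do rewrite -galois_map_swap.
have hl := coact_antipode_islin.
rewrite -(big_morph _ (islinD hl) (islin0 hl)).
have -> : \sum_(p <- repr (g (1 ⊠ S h))) (p.1 ⊠ 1 : B ⊗ H) * rho p.2 = 1 ⊠ S h
  by apply: gK.
rewrite coact_antipodeE (coact_alg rho).1 -tensor1 tliftE; last by multilinear.
by rewrite mul1r invS.
Qed.

Section Trace.
Variables (Λ : H) (λ : H -> k^o) (s : seq (B * B)).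
Hypotheses (intΛ : left_integral hH Λ) (linλ : islin λ) (λΛ : λ Λ = 1).
Hypothesis coinvλ :
  forall h, \sw_(a, b <- Δ h) (λ b : k) *: a = (λ h : k) *: 1.
Hypothesis regλ : forall h,
  \sw_(x, y <- Δ Λ) λ (S x * h * y) = (ε Λ : k) *: λ (S h).
Hypothesis canΛ : \sum_(p <- s) rho p.1 * (p.2 ⊠ 1 : B ⊗ H) = 1 ⊠ Λ :> B ⊗ H.

(** The relation [Σ x0 y ⊗ x1 = 1 ⊗ Λ] in the form in which it is used. *)
Lemma galois_preimage_sum (P : lmodType k) (F : B -> H -> P) : bilin F ->
  \sum_(p <- s) (\sw_(x0, x1 <- rho p.1) F (x0 * p.2) x1) = F 1 Λ.
Proof.
move=> hF; have hl := tlift_islin hF.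
rewrite -(tliftE 1 Λ hF) -canΛ (big_morph _ (islinD hl) (islin0 hl)).
apply: eq_bigr => p _; rewrite mul_tensorr (islin_tlift _ _ hl).
by apply: eq_tlift => x0 x1; rewrite tliftE // mulr1.
Qed.

Definition integral_trace (b : B) : B := \sw_(b0, b1 <- rho b) (λ b1 : k) *: b0.

Lemma integral_trace_islin : islin integral_trace.
Proof. by rewrite /integral_trace; multilinear. Qed.

(** [b0 ⊗ b1 λ(b2) = b0 λ(b1) ⊗ 1] by coassociativity and [coinvλ]. *)
Lemma integral_trace_coinvariant b : coinvariant rho (integral_trace b).
Proof.
apply/asboolP; rewrite /integral_trace.
rewrite (islin_tlift _ _ (linearP rho : islin rho)).
under eq_tlift => b0 b1.
  rewrite linearZ /= -[rho b0]tlift_tensorK.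
  rewrite (islin_tlift (G := fun z => (λ b1 : k) *: z)); last by multilinear.
  over.
rewrite (coactA_tlift (F := fun c0 c1 b1 => (λ b1 : k) *: (c0 ⊠ c1 : B ⊗ H)));
  last by multilinear.
rewrite (islin_tlift (G := fun z => z ⊠ 1 : B ⊗ H)); last by multilinear.
apply: eq_tlift => b0 b1; rewrite tensorZl -tensorZr -coinvλ.
rewrite (islin_tlift (G := fun z => b0 ⊠ z : B ⊗ H)); last by multilinear.
by apply: eq_tlift => h1 h2; rewrite tensorZr.
Qed.

Definition coinv_trace (b : B) : A :=
  Sub (integral_trace b) (integral_trace_coinvariant b).

Lemma val_coinv_trace b : val (coinv_trace b) = integral_trace b.
Proof. exact: SubK. Qed.

Lemma coinv_traceD b b' : coinv_trace (b + b') = coinv_trace b + coinv_trace b'.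
Proof.
apply: val_inj; rewrite rmorphD /= !val_coinv_trace.
exact: (islinD integral_trace_islin).
Qed.

Lemma coinv_traceM (a : A) b : coinv_trace (val a * b) = a * coinv_trace b.
Proof.
apply: val_inj; rewrite rmorphM /= !val_coinv_trace /integral_trace.
rewrite coactM_tlift; last by multilinear.
rewrite coinvariant_val tliftE; last by multilinear.
rewrite (islin_tlift (G := fun z => val a * z)); last by multilinear.
by apply: eq_tlift => b0 b1; rewrite mul1r scalerAr.
Qed.

(** [Σ b0 x0 λ(b1 x1) y = b0 λ(b1 Λ) = b0 ε(b1)]. *)
Lemma coinv_dual_basis b : \sum_(p <- s) integral_trace (b * p.1) * p.2 = b.
Proof.
transitivity (\sw_(b0, b1 <- rho b) (λ (b1 * Λ) : k) *: (b0 * 1)); last first.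
  under eq_tlift => b0 b1.
    rewrite mulr1 intΛ (islinZ _ _ linλ) λΛ [_ *: 1]mulr1.
    over.
  by rewrite (coact_counit_tlift (G := id)) //; multilinear.
rewrite -(galois_preimage_sum (F := fun u h =>
    \sw_(b0, b1 <- rho b) (λ (b1 * h) : k) *: (b0 * u)));
  last by multilinear.
apply: eq_bigr => p _.
rewrite /integral_trace coactM_tlift; last by multilinear.
rewrite (islin_tlift (G := fun z => z * p.2)); last by multilinear.
rewrite exchange_tlift; apply: eq_tlift => b0 b1.
rewrite (islin_tlift (G := fun z => z * p.2)); last by multilinear.
by apply: eq_tlift => x0 x1; rewrite -scalerAl mulrA.
Qed.

Section TraceForm.
Variable f : {linear B -> k^o}.
Hypothesis trf : forall b b', f (b * b') = f (b' * b).

(** The relation [Σ x0 y ⊗ x1 = 1 ⊗ Λ] implies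
    [Σ x0 y0 ⊗ y1 ⊗ x1 = 1 ⊗ S(Λ1) ⊗ Λ2]: coact on the first factor, split the
    last one, and cancel [S(x2) x1].  What remains of [H] is the regular
    character [regλ]. *)
Lemma galois_preimage_trace (u : B) (h : H) :
  \sum_(p <- s) (\sw_(x0, x1 <- rho p.1) \sw_(y0, y1 <- rho p.2)
     (f (u * x0 * y0) * λ (y1 * h * x1) : k^o)) =
  f u * ((ε Λ : k) *: λ (S h)).
Proof.
pose F b q : k^o := \sw_(b0, b1 <- rho b) \sw_(q1, q2 <- Δ q)
    (f (u * b0) * λ (S q1 * b1 * h * q2) : k^o).
have -> : f u * ((ε Λ : k) *: λ (S h)) = F 1 Λ.
  rewrite /F (coact_alg rho).1 -tensor1 tliftE; last by multilinear.
  rewrite -regλ (islin_tlift (G := fun z : k^o => f u * z : k^o));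
    last by multilinear.
  by apply: eq_tlift => q1 q2; rewrite !mulr1.
rewrite -galois_preimage_sum; last by rewrite /F; multilinear.
apply: eq_bigr => p _; rewrite /F.
under [RHS]eq_tlift => x0 x1.
  rewrite coactM_tlift; last by multilinear.
  over.
rewrite (coactA_tlift (F := fun c0 c1 x1 => \sw_(y0, y1 <- rho p.2)
    \sw_(q1, q2 <- Δ x1)
      (f (u * (c0 * y0)) * λ (S q1 * (c1 * y1) * h * q2) : k^o)));
  last by multilinear.
apply: eq_tlift => x0 x1.
under [RHS]eq_tlift => h1 h2 do rewrite exchange_tlift.
rewrite -(coassoc_tlift hH (F := fun h1 q1 q2 =>
    \sw_(y0, y1 <- rho p.2)
      (f (u * (x0 * y0)) * λ (S q1 * (h1 * y1) * h * q2) : k^o)));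
  last by multilinear.
under [RHS]eq_tlift => t q2.
  under eq_tlift => h1 q1 do under eq_tlift => y0 y1 do rewrite [S q1 * _]mulrA.
  rewrite (antipode_opl_tlift invS (G := fun z =>
      \sw_(y0, y1 <- rho p.2) (f (u * (x0 * y0)) * λ (z * y1 * h * q2) : k^o)));
    last by multilinear.
  over.
rewrite (counitl_tlift hH (G := fun q2 =>
    \sw_(y0, y1 <- rho p.2) (f (u * (x0 * y0)) * λ (1 * y1 * h * q2) : k^o)));
  last by multilinear.
by apply: eq_tlift => y0 y1; rewrite mulrA mul1r.
Qed.

(** As [x] and [y] form a dual basis, the left-hand side is [f] of the trace
    over [A] of right multiplication by [c] on [B].  The form [f] being a trace,
    the factor [y0 c0 x0] may be rotated to [c0 x0 y0], to which
    [galois_preimage_trace] applies. *)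
Lemma trace_form_rmul (c : B) :
  \sum_(p <- s) f (integral_trace (p.2 * c * p.1)) =
  (ε Λ : k) *: (\sw_(c0, c1 <- rho c) (f c0 * λ (S c1) : k^o)).
Proof.
transitivity (\sw_(c0, c1 <- rho c) (f c0 * ((ε Λ : k) *: λ (S c1)) : k^o));
    last first.
  rewrite (islin_tlift (G := fun z : k^o => (ε Λ : k) *: z));
    last by multilinear.
  by apply: eq_tlift => c0 c1; rewrite scalerAr.
under [RHS]eq_tlift => c0 c1 do rewrite -galois_preimage_trace.
rewrite -tlift_sum; apply: eq_bigr => p _.
rewrite /integral_trace (islin_tlift _ _ (linearP f : islin f)).
rewrite coactM_tlift; last by multilinear.
rewrite coactM_tlift; last by multilinear.
rewrite exchange_tlift; apply: eq_tlift => c0 c1.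
rewrite exchange_tlift; apply: eq_tlift => x0 x1.
apply: eq_tlift => y0 y1.
by rewrite linearZ /= -!mulrA trf -!mulrA [_ *: _]mulrC.
Qed.

End TraceForm.
End Trace.
End Galois.

(** * Ranks as traces *)

Section LocalRank.
Variable A : comNzRingType.

(** An ideal that is maximal among the proper ideals containing the annihilator
    of [d] is prime, and no element outside it kills [d]. *)
Lemma exists_prime_local_neq0 (d : A) : d != 0 ->
  exists p : prime_idealr A, @to_local A p d != 0.
Proof.
(* Sets in [P] may be empty, so that the union of the empty chain is allowed. *)
move=> d0; pose P := [set X : set A | [/\
  (forall a x y, X x -> X y -> X (a * x + y)),
  ~ X 1 & (exists x, X x) -> forall u, u * d = 0 -> X u]]%classic.
have [F FP Ftot | I [[Ilin I1 Iann] Imax]] := @Zorn_bigcup A P.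
  split=> [a x y [X FX Xx] [Y FY Yy] | [X FX X1] | [x [X FX Xx]] u ud].
  - case: (Ftot _ _ FX FY) => XY.
      by exists Y => //; have [h _ _] := FP _ FY; apply: h => //; apply: XY.
    by exists X => //; have [h _ _] := FP _ FX; apply: h => //; apply: XY.
  - by have [_ + _] := FP _ FX.
  - by exists X => //; have [_ _ h] := FP _ FX; apply: h => //; exists x.
have Pann : P [set u | u * d = 0]%classic.
  split=> //= [a x y xd yd|]; first by rewrite mulrDl -mulrA xd yd mulr0 addr0.
  by rewrite mul1r; apply/eqP.
have Iex : exists x, I x.
  apply: contrapT => Ie; apply: (Imax _ _ Pann); split=> [|sub].
    by move=> x Ix; case: Ie; exists x.
  by apply: Ie; exists 0; apply: sub => /=; rewrite mul0r.
have {}Iann := Iann Iex.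
have I0 : I 0 by apply: Iann; rewrite mul0r.
have Iprime u v : I (u * v) -> I u \/ I v.
  move=> Iuv; case: (pselect (I u)) => [|nIu]; [by left | right].
  apply: contrapT => nIv.
  pose J := [set z | exists2 x, I x & exists b, z = x + b * u]%classic.
  apply: (Imax J).
    split=> [x Ix | sub].
      by exists x => //; exists 0; rewrite mul0r addr0.
    by apply: nIu; apply: sub; exists 0 => //; exists 1; rewrite mul1r add0r.
  split=> [a _ _ [x Ix [b ->]] [y Iy [c ->]] | [x Ix [b eq1]] | _ z zd].
  - exists (a * x + y); first exact: Ilin.
    by exists (a * b + c); rewrite mulrDr mulrDl addrACA mulrA.
  - have eqv : v = b * (u * v) + (v * x + 0).
      by rewrite addr0 addrC mulrA (mulrC v) -mulrDl -eq1 mul1r.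
    by apply: nIv; rewrite eqv; apply: (Ilin) => //; apply: (Ilin).
  - by exists z; [exact: Iann | exists 0; rewrite mul0r addr0].
pose S (x : A) := `[< I x >].
have Sid : idealr_closed S.
  split=> [||a x y /asboolP Ix /asboolP Iy]; [exact/asboolP | exact/asboolP | ].
  by apply/asboolP/Ilin.
have Spr : prime_idealr_closed S.
  by move=> u v /asboolP /Iprime [] h; apply/orP; [left | right]; apply/asboolP.
pose p : prime_idealr A := HB.pack S (isIdealr.Build A S Sid)
  (isPrimeIdealrClosed.Build A S Spr).
exists p; apply/eqP => /fracP[[u pu]] /=; rewrite !mulr1 mulr0 => ud.
by move/negP: pu; apply; apply/asboolP/Iann.
Qed.

Lemma eq_to_local (a b : A) :
  (forall p : prime_idealr A, @to_local A p a = @to_local A p b) -> a = b.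
Proof.
move=> h; apply/eqP; rewrite -subr_eq0; apply/negPn/negP.
by move=> /exists_prime_local_neq0[p]; rewrite rmorphB /= h subrr eqxx.
Qed.

Section Trace.
Variables (M : lmodType A) (I : Type) (r : seq I) (v : I -> M)
  (v' : I -> M -> A).
Hypothesis linv : forall i, linear (v' i : M -> A^o).
Hypothesis vv' : forall m, \sum_(i <- r) v' i m *: v i = m.

(** The trace does not depend on the dual basis: over the localization, compare
    the one induced by [v] with the standard basis of a free module by
    exchanging the two sums. *)
Lemma local_trace (p : prime_idealr A) (n : nat) :
  free_of_rank (ext_scalars (@to_local A p) M) n ->
  @to_local A p (\sum_(i <- r) v' i (v i)) = n%:R.
Proof.
case=> g [g' gK g'K].
pose φ i (z : ext_scalars (@to_local A p) M) :=
  tlift (fun (x : local p) m => x * @to_local A p (v' i m)) z.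
have φbal i : balanced (fun x a => x * @to_local A p a) (fun a m => a *: m)
    (fun (x : local p) m => x * @to_local A p (v' i m)).
  have vD m m' : v' i (m + m') = v' i m + v' i m'.
    by have := linv i 1 m m'; rewrite !scale1r.
  have v0 : v' i 0 = 0.
    by apply: (addIr (v' i 0)); rewrite -vD !add0r.
  split=> [x y m | x m m' | x a m]; first by rewrite mulrDl.
    by rewrite vD rmorphD mulrDr.
  have := linv i a m 0; rewrite !addr0 v0 addr0 => ->.
  by rewrite [in RHS]rmorphM mulrA.
have φE i x m : φ i (x ⊠ m) = x * @to_local A p (v' i m).
  exact: (tlift_tensor (φbal i)).
have φD i : {morph φ i : z w / z + w} by move=> z w; apply: (tliftD (φbal i)).
have φZ i c z : φ i (c *: z) = c * φ i z.
  elim/tens_ind: z => [x m | z w hz hw]; last first.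
    by rewrite scalerDr !φD hz hw mulrDr.
  by rewrite [c *: _]ext_scaleE !φE mulrA.
pose w i : ext_scalars (@to_local A p) M := 1 ⊠ v i.
have φw z : \sum_(i <- r) φ i z *: w i = z.
  elim/tens_ind: z => [x m | z1 z2 h1 h2]; last first.
    by under eq_bigr do rewrite φD scalerDl; rewrite big_split h1 h2.
  rewrite -[in RHS](vv' m).
  have t0 : x ⊠ 0 = 0 :> ext_scalars (@to_local A p) M.
    by apply: (addIr (x ⊠ 0)); rewrite -tensorDr !add0r.
  rewrite [RHS](big_morph _ (tensorDr _ _ x) t0); apply: eq_bigr => i _.
  by rewrite [LHS]ext_scaleE φE mulr1 tensor_bal.
rewrite rmorph_sum /=.
transitivity (\sum_(i <- r) \sum_t φ i (g (delta_mx 0 t)) * g' (w i) 0 t).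
  apply: eq_bigr => i _.
  rewrite -[LHS]mul1r -φE -/(w i) -[w i in LHS]g'K.
  rewrite [X in g X]row_sum_delta linear_sum.
  have φ0 : φ i 0 = 0 by rewrite -(scale0r 0) φZ mul0r.
  rewrite (big_morph _ (φD i) φ0); apply: eq_bigr => t _.
  by rewrite linearZ φZ mulrC.
rewrite exchange_big /= -[n in RHS]card_ord -sumr_const.
apply: eq_bigr => t _.
have : \sum_(i <- r) φ i (g (delta_mx 0 t)) *: g' (w i) = delta_mx 0 t.
  apply: (can_inj gK); rewrite linear_sum -[RHS]φw; apply: eq_bigr => i _.
  by rewrite linearZ g'K.
move/(congr1 (fun m : 'rV_n => m 0 t)).
rewrite summxE [RHS]mxE !eqxx => E; apply: etrans _ E.
by apply: eq_bigr => i _; rewrite mxE.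
Qed.

Lemma rank_trace : rank M <> 0%N -> \sum_(i <- r) v' i (v i) = (rank M)%:R.
Proof.
rewrite /rank; case: xgetP => // n _ hn n0.
apply: eq_to_local => p; rewrite rmorph_nat; apply: local_trace.
have := hn p; rewrite /local_rank; case: xgetP => [m -> + <- // | _ h].
by case: n0.
Qed.

End Trace.
End LocalRank.

(** * Ranks over the coinvariants *)

Theorem theorem9 (k : comNzRingType) (H : algType k) (hH : hopf H)
    (B : algType k) (rho : comodule_algebra hH B)
    (A : subComNzRingType (coinvariant rho)) :
  involutory hH ->
  frobenius H ->
  hopf_galois A ->
  (forall e : A, e * e = e -> e = 0 \/ e = 1) ->
  (exists f : {linear B -> k^o},
     (forall b b' : B, f (b * b' - b' * b) = 0) /\ f 1 = 1) ->
  forall M : lmodType B, fg_projective M ->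
    integral_ideal hH (rank (restr_scalars (val : A -> B) M))%:R.
Proof.
move=> invS frobH galA _ [f [trf f1]] M projM.
(* A nonzero value of [rank] guarantees that all localizations are free of
   that rank. *)
set N := restr_scalars _ M; have [-> | /eqP rk0] := eqVneq (rank N) 0%N.
  exists 0; last by rewrite linear0.
  by move=> b /=; rewrite mulr0 scaler0.
have {}trf b b' : f (b * b') = f (b' * b).
  by apply/eqP; rewrite -subr_eq0 -linearB trf.
have [Λ [λ [intΛ linλ λΛ coinvλ regλ]]] :=
  involutory_frobenius_integrals invS frobH.
have [s canΛ] := hopf_galois_preimage invS Λ galA.
have [n [m [m' mm']]] := fg_projective_dual_basis projM.
pose r := [seq (i, p) | i <- index_enum 'I_n, p <- s].
pose v (j : 'I_n * (B * B)) : N := j.2.2 *: m j.1.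
pose v' (j : 'I_n * (B * B)) (x : N) : A :=
  coinv_trace A linλ coinvλ (m' j.1 x * j.2.1).
have linv j : linear (v' j : N -> A^o).
  move=> a x y; rewrite /v' linearD mulrDl coinv_traceD; congr (_ + _).
  by rewrite -[a *: x]/(val a *: (x : M)) linearZ /= -mulrA coinv_traceM.
have vv' x : \sum_(j <- r) v' j x *: v j = x.
  rewrite big_allpairs -[RHS]mm'; apply: eq_bigr => i _.
  rewrite -[in RHS](coinv_dual_basis intΛ linλ λΛ canΛ (m' i x)) scaler_suml.
  apply: eq_bigr => p _.
  by rewrite -[LHS]/(val (v' (i, p) x) *: (p.2 *: m i)) val_coinv_trace scalerA.
have := rank_trace linv vv' rk0; rewrite big_allpairs exchange_big /= => trN.
(* [c] represents the trace over [B] of the identity of [M]. *)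
pose c := \sum_i m' i (m i).
exists (((\sw_(c0, c1 <- rho c) (f c0 * λ (antipode hH c1) : k^o)) : k) *: Λ).
  by move=> b /=; rewrite -scalerAr intΛ !scalerA mulrC.
rewrite linearZ /= [_ *: _]mulrC.
rewrite -[LHS](trace_form_rmul invS linλ regλ canΛ trf).
have <- : f (val ((rank N)%:R : A)) = (rank N)%:R.
  by rewrite rmorph_nat /= linearMn f1.
rewrite -trN rmorph_sum linear_sum; apply: eq_bigr => p _.
have hl := integral_trace_islin rho linλ.
rewrite rmorph_sum /c mulr_sumr mulr_suml.
rewrite (big_morph _ (islinD hl) (islin0 hl)) /=.
congr (f _); apply: eq_bigr => i _.
by rewrite val_coinv_trace linearZ.
Qed.
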